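(* Let $s\in(0,1)$, $p>2$, and let $n\geq 1$ be an integer. Let $u:\mathbb{R}^n\to\mathbb{R}$ be the function $u(x)=(1-|x|^2)^s_+$. Then $(-\Delta)^s_p u(x)$ is uniformly bounded in the unit ball $B_1\subset\mathbb{R}^n$; that is, there is a constant $C$ such that $|(-\Delta)^s_p u(x)|\leq C$ for all $x\in B_1$.
   Context: $B_1=\{x\in\mathbb{R}^n: |x|<1\}$ is the open unit ball. The function $(1-|x|^2)^s_+$ equals $(1-|x|^2)^s$ for $|x|<1$ and $0$ for $|x|\geq 1$. The fractional $p$-Laplacian is defined pointwise by $$(-\Delta)^s_p u(x)=C_{n,s,p}\,\mathrm{P.V.}\int_{\mathbb{R}^n}\frac{|u(x)-u(y)|^{p-2}[u(x)-u(y)]}{|x-y|^{n+sp}}\,dy = C_{n,s,p}\lim_{\epsilon\to0^+}\int_{\mathbb{R}^n\setminus B_\epsilon(x)}\frac{|u(x)-u(y)|^{p-2}[u(x)-u(y)]}{|x-y|^{n+sp}}\,dy,$$ where $C_{n,s,p}$ is a constant depending only on $n,s,p$, and $B_\epsilon(x)$ is the ball of radius $\epsilon$ centered at $x$. *)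

(* Defs.v *)
From HB Require Import structures.
From mathcomp Require Import all_boot all_order all_algebra.
From mathcomp Require Import all_classical all_reals all_analysis.

Set Implicit Arguments.
Unset Strict Implicit.
Unset Printing Implicit Defensive.
Import Order.TTheory GRing.Theory Num.Theory.
Import numFieldNormedType.Exports.

Local Open Scope classical_set_scope.
Local Open Scope ring_scope.

(* Points of R^n are n-tuples, on which the library puts the product of the
   Borel sigma-algebras; row vectors have no sigma-algebra, and their library
   norm is the sup norm. *)
Notation Rn R n := (n.-tuple (measurableTypeR R)).

Section lebesgue_measure_Rn.
Variable R : realType.

Definition cons_Rn n (z : measurableTypeR R * Rn R n) : Rn R n.+1 :=
  [the Rn R n.+1 of z.1 :: z.2].

Lemma measurable_cons_Rn n : measurable_fun [set: _] (@cons_Rn n).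
Proof. exact: measurable_cons. Qed.

Section step.
Variables (n : nat) (mu : {measure set (Rn R n) -> \bar R}).

(* The product of the Lebesgue measure on R and of mu, seen on R^(n+1). *)
Definition lebesgue_step : set (Rn R n.+1) -> \bar R :=
  pushforward (@lebesgue_measure R \x^ mu)%E (@cons_Rn n).

Let lebesgue_step0 : lebesgue_step set0 = 0%E.
Proof. by rewrite /lebesgue_step /pushforward preimage_set0 measure0. Qed.

Let lebesgue_step_ge0 A : (0 <= lebesgue_step A)%E.
Proof. exact: integral_ge0. Qed.

Let lebesgue_step_sigma_additive : semi_sigma_additive lebesgue_step.
Proof.
move=> F mF tF mUF; rewrite /lebesgue_step /pushforward preimage_bigcup.
apply: measure_semi_sigma_additive.
- by move=> k; rewrite -[X in measurable X]setTI; exact: measurable_cons_Rn.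
- apply/trivIsetP => /= i j _ _ ij; rewrite -preimage_setI.
  by move/trivIsetP : tF => /(_ _ _ _ _ ij) ->//; rewrite preimage_set0.
- rewrite -preimage_bigcup -[X in measurable X]setTI.
  exact: measurable_cons_Rn.
Qed.

HB.instance Definition _ := isMeasure.Build _ _ _ lebesgue_step
  lebesgue_step0 lebesgue_step_ge0 lebesgue_step_sigma_additive.

End step.

Fixpoint lebesgue_measure_Rn n : {measure set (Rn R n) -> \bar R} :=
  match n with
  | 0 => dirac ([tuple] : Rn R 0)
  | m.+1 => lebesgue_step (lebesgue_measure_Rn m)
  end.

Lemma lebesgue_measure_Rn_box n (A : 'I_n -> set (measurableTypeR R)) :
  (forall i, measurable (A i)) ->
  lebesgue_measure_Rn n [set x | forall i, A i (tnth x i)] =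
  (\prod_(i < n) lebesgue_measure (A i))%E.
Proof.
elim: n A => [|n IHn] A mA /=.
  by rewrite big_ord0 diracE mem_set// => -[].
have mbox : measurable [set x : Rn R n | forall i, A (lift ord0 i) (tnth x i)].
  rewrite [X in measurable X](_ : _ =
      \bigcap_(i in [set: 'I_n]) (@tnth n _ ^~ i @^-1` A (lift ord0 i))); last first.
    by apply/seteqP; split=> [x xA i _|x xA i]; [exact: xA|exact: (xA i)].
  apply: fin_bigcap_measurable => // i _.
  by rewrite -[X in measurable X]setTI; exact: measurable_tnth.
rewrite big_ord_recl -(IHn (fun i => A (lift ord0 i)))//.
rewrite /lebesgue_step /pushforward -product_measure2E//; congr (_ _).
apply/seteqP; split=> [[a x]/= ax|[a x]/= [aA xA] i].
- split; first by have := ax ord0.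
  by move=> i; have := ax (lift ord0 i); rewrite /cons_Rn tnthS.
- by case: (unliftP ord0 i) => [j|] ->; rewrite /cons_Rn ?tnthS.
Qed.

End lebesgue_measure_Rn.

Section fractional_p_laplacian.
Variables (R : realType) (n : nat).
Implicit Types (x y : Rn R n) (u : Rn R n -> R).

Definition enorm x : R := Num.sqrt (\sum_(i < n) tnth x i ^+ 2).

Definition edist x y : R := Num.sqrt (\sum_(i < n) (tnth x i - tnth y i) ^+ 2).

Definition eball x (e : R) : set (Rn R n) := [set y | edist x y < e].

(* The division by zero at y = x is harmless: that point is never in the domain
   of integration. *)
Definition fracp_kernel (s p : R) u x y : R :=
  `|u x - u y| `^ (p - 2) * (u x - u y) / edist x y `^ (n%:R + s * p).

Definition fracp_trunc (s p : R) u x (e : R) : R :=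
  \int[lebesgue_measure_Rn R n]_(y in ~` eball x e) fracp_kernel s p u x y.

(* Since Rintegral and lim are total functions, the existence of the principal
   value is a separate predicate. *)
Definition fracp_laplacian_exists (s p : R) u x : Prop :=
  (forall e : R, 0 < e ->
    (lebesgue_measure_Rn R n).-integrable (~` eball x e)
      (EFin \o fracp_kernel s p u x)) /\
  cvg (fracp_trunc s p u x e @[e --> 0^'+]).

(* Cnsp n s p is the normalizing constant. *)
Definition fracp_laplacian (Cnsp : nat -> R -> R -> R) (s p : R) u x : R :=
  Cnsp n s p * lim (fracp_trunc s p u x e @[e --> 0^'+]).

Definition ball_power (s : R) x : R :=
  if enorm x < 1 then (1 - enorm x ^+ 2) `^ s else 0.

End fractional_p_laplacian.

(* Main.v *)
From HB Require Import structures.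
Require Import Defs.
From mathcomp Require Import all_boot all_order all_algebra.
From mathcomp Require Import all_classical all_reals all_analysis measurable_realfun.
From mathcomp Require Import ring lra.
Import Order.TTheory GRing.Theory Num.Theory.
Import numFieldNormedType.Exports.
Set Implicit Arguments.
Unset Strict Implicit.
Unset Printing Implicit Defensive.
Local Open Scope classical_set_scope.
Local Open Scope ring_scope.

(** Write G(D) for the odd power |D|^(p-2) D and u(x) = (1 - |x|^2)_+^s.  The
    estimate is delicate: adding up the values of the integrand at points that
    are symmetric about x and then taking absolute values only gives the bound
    (1 - |x|)^(-s), so a further cancellation has to be used.  It comes
    from dimension one: on the half-line the function z_+^s has fractional
    p-Laplacian zero.

    Reduction to lines.  Put y = x + t (1, eta) with t real and eta in
    R^(n-1).  Fubini and the scaling of Lebesgue measure give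
    dy = |t|^(n-1) dt d(eta), so the truncated integral at x is an integral
    over the directions (1, eta) of truncated integrals along the lines through
    x ([integral_pencil]).  With l = |(1, eta)|, restricting u to such a line
    gives l^(2s) ((a + t) (b - t))_+^s, where -a and b are the two parameters
    at which the line leaves the ball ([ray_roots]).  All powers of l combine
    to l^(-n), which is integrable in eta ([weight_lty]: its integral is
    proportional to the volume of a ball), so a bound on chords that scales
    correctly in a + b is enough.

    One chord.  Let a <= b, c = a + b and z = a + t, so that the profile is
    (z (c - z))^s.  Its derivative divided by that of z^s is the function
    [slope], which is Lipschitz on [0, 3c/4]; hence by Cauchy's mean value
    theorem increments of the profile are increments of z^s times a factor that
    differs from its value at z = a by at most a multiple of c^(s-1) |t|
    ([chord_slope]).  Since G is multiplicative and |a^s - z^s| <= |a - z|^s,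
    replacing the chord by a constant multiple of the half-line changes the
    integrand by at most a multiple of c^(s(p-1)-1) |t|^(-s) near t = 0, which
    is integrable without any cancellation ([err_sym_near], [err_sym_far]).

    The half-line.  The inversion z -> a^2 / z maps the right of the point a to
    the left of it.  It turns the right integrand into the left one times
    (z/a)^(s-1), and the difference of these two is an exact derivative,
    that of |a^s - z^s|^p / |a - z|^(sp) up to a constant
    ([is_derive_mirror_prim]).  So the truncated integral is explicit, and it
    is O(e^(1-s) / a) as the truncation radius e tends to zero
    ([half_line_cancel]).

    Consequently the truncations at x are Cauchy, with a rate that depends on
    1 - |x|^2, whereas the limit is bounded by a constant that does not:
    the dependence on x only enters through terms in e^(1-s) ([pv_estimate]). *)

(** * Affine changes of variable on the line *)

Section affine_line.
Variable R : realType.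
Local Notation mu := (@lebesgue_measure R).
Local Open Scope ereal_scope.

Lemma measurable_affine (a b : R) :
  measurable_fun [set: measurableTypeR R]
    (fun t : measurableTypeR R => (a + b * t)%R : measurableTypeR R).
Proof.
apply: measurable_realfun.measurable_funD => //.
Qed.

Lemma affine_preimage_itv (a b x y : R) : b != 0%R ->
  mu ((fun t => a + b * t)%R @^-1` `]x, y]) = `|b|^-1%:E * mu `]x, y].
Proof.
move=> b0.
have [bp|bn] : (0 < b \/ b < 0)%R by case: (ltgtP b 0%R) b0 => //; [right|left].
- have -> : (fun t => a + b * t)%R @^-1` `]x, y] =
      `]((x - a) / b)%R, ((y - a) / b)%R]%classic.
    apply/seteqP; split => t /=; rewrite !in_itv/= ltr_pdivrMr// ler_pdivlMr//;
    by rewrite ltrBlDr lerBrDr addrC mulrC.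
  rewrite !lebesgue_measure_itv/= !lte_fin ltr_pM2r ?invr_gt0// ltrD2r.
  case: ifPn => xy; last by rewrite mule0.
  rewrite -!EFinB -EFinM gtr0_norm//; congr EFin; field; exact: lt0r_neq0.
- have -> : (fun t => a + b * t)%R @^-1` `]x, y] =
      `[((y - a) / b)%R, ((x - a) / b)%R[%classic.
    apply/seteqP; split => t /=; rewrite !in_itv/= ler_ndivrMr// ltr_ndivlMr//;
    by rewrite ltrBlDr lerBrDr [(t * b)%R]mulrC [(_ + a)%R]addrC andbC.
  rewrite !lebesgue_measure_itv/= !lte_fin ltr_nM2r ?invr_lt0// ltrD2r.
  case: ifPn => xy; last by rewrite mule0.
  rewrite -!EFinB -EFinM ltr0_norm//; congr EFin; field; exact: ltr0_neq0.
Qed.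

Lemma ge0_integral_affine (a b : R) (f : R -> \bar R) : b != 0%R ->
  measurable_fun [set: R] f -> (forall t, 0 <= f t) ->
  \int[mu]_t f t = `|b|%:E * \int[mu]_t f (a + b * t)%R.
Proof.
move=> b0 mf f0.
pose phi (t : measurableTypeR R) : measurableTypeR R := (a + b * t)%R.
pose nu1 : {measure set (measurableTypeR R) -> \bar R} := pushforward mu phi.
pose nu : {measure set (measurableTypeR R) -> \bar R} :=
  mscale (NngNum (normr_ge0 b)) (nu1 (measurable_affine a b)).
transitivity (\int[nu]_t f t).
  apply: eq_measure_integral => A mA _; apply: lebesgue_measure_unique => //.
  move=> _ [[x y]] _ <-; rewrite /nu /= /mscale /pushforward/=.
  rewrite [X in (_ * X)](@affine_preimage_itv a b x y b0).
  by rewrite muleA -EFinM divff ?mul1e// normr_eq0.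
rewrite ge0_integral_mscale//=; congr (_ * _).
rewrite (ge0_integral_pushforward (measurable_affine a b))//.
Qed.

(** Folding the line at 0 lets the two directions of a line be treated
    together, which is where the principal value cancels. *)
Lemma ge0_integral_symm (f : R -> \bar R) :
  measurable_fun [set: R] f -> (forall t, 0 <= f t) ->
  \int[mu]_t f t = \int[mu]_(t in `]0%R, +oo[) (f t + f (- t)%R).
Proof.
move=> mf f0.
have mfN : measurable_fun [set: R] (fun t => f (- t)%R).
  by apply: (measurableT_comp mf); exact: measurable_funN.
rewrite -(setUv (`]0%R, +oo[%classic : set (measurableTypeR R))).
rewrite ge0_integral_setU//=; first last.
- exact/disj_setPCl.
- by apply: measurable_funTS.
- exact: measurableC.
rewrite ge0_integralD//; first last.
- exact: measurable_funTS.
- exact: measurable_funTS.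
congr (_ + _).
rewrite setCitvr/=.
have := @ge0_integration_by_substitution0 R _ mfN (fun r => f0 _).
rewrite integral_itv_obnd_cbnd; last exact: measurable_funTS.
by move=> ->; apply: eq_integral => t _; rewrite opprK.
Qed.

End affine_line.

(** * Lebesgue measure on R^n in coordinates *)

Section lebesgue_Rn.
Variable R : realType.
Local Notation mu := (@lebesgue_measure R).

Lemma measurable_box n (A : 'I_n -> set (measurableTypeR R)) :
  (forall i, measurable (A i)) ->
  measurable [set x : Rn R n | forall i, A i (tnth x i)].
Proof.
move=> mA; rewrite [X in measurable X](_ : _ =
    \bigcap_(i in [set: 'I_n]) (@tnth n _ ^~ i @^-1` A i)); last first.
  by apply/seteqP; split=> [x xA i _|x xA i]; [exact: xA|exact: (xA i)].
apply: fin_bigcap_measurable => // i _.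
by rewrite -[X in measurable X]setTI; exact: measurable_tnth.
Qed.

Definition cube n (r : R) : set (Rn R n) :=
  [set x | forall i, `[-r, r]%classic (tnth x i)].

Lemma measurable_cube n r : measurable (@cube n r).
Proof. exact: (@measurable_box n (fun _ => `[-r, r]%classic)). Qed.

Lemma lebesgue_cube_lty n r : (lebesgue_measure_Rn R n (@cube n r) < +oo)%E.
Proof.
rewrite (@lebesgue_measure_Rn_box R n (fun _ => `[-r, r]%classic))//.
have : (\prod_(i < n) mu `[(- r)%R, r]%classic)%E \is a fin_num.
  apply: prode_fin_num => i _; rewrite lebesgue_measure_itv.
  by case: ifP.
by rewrite fin_numE => /andP[_]; rewrite lt_neqAle leey andbT.
Qed.

(** An alias of the measure, to which the sigma-finiteness required by Fubini's
    theorem can be attached. *)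
Definition leb n : set (Rn R n) -> \bar R := lebesgue_measure_Rn R n.
HB.instance Definition _ n := Measure.on (@leb n).

Let leb_sigma_finite n : sigma_finite setT (@leb n).
Proof.
exists (fun k => @cube n k%:R); last first.
  by move=> k; split; [exact: measurable_cube|exact: lebesgue_cube_lty].
apply/esym; rewrite -subTset => x _.
pose M := \sum_(i < n) `|tnth x i|.
exists (Num.trunc M).+1 => // i; rewrite /= in_itv/= -ler_norml.
have : M < (Num.trunc M).+1%:R by exact: truncnS_gt.
move=> /ltW; apply: le_trans; rewrite /M (bigD1 i)//= lerDl.
exact: sumr_ge0.
Qed.

HB.instance Definition _ n :=
  Measure_isSigmaFinite.Build _ _ _ (@leb n) (@leb_sigma_finite n).

Local Open Scope ereal_scope.

Lemma ge0_integral_cons n (f : Rn R n.+1 -> \bar R) :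
  measurable_fun setT f -> (forall x, 0 <= f x) ->
  \int[lebesgue_measure_Rn R n.+1]_x f x =
  \int[mu]_t \int[@leb n]_y f (cons_Rn (t, y)).
Proof.
move=> mf f0.
have mc := @measurable_cons_Rn R n.
transitivity (\int[(mu \x^ @leb n)]_z f (cons_Rn z)).
  have := ge0_integral_pushforward mc (mu \x^ @leb n) measurableT mf
    (fun y _ => f0 y).
  by rewrite preimage_setT => <-; exact: eq_measure_integral.
transitivity (\int[(mu \x @leb n)]_z f (cons_Rn z)).
  apply: eq_measure_integral => //= A mA _; apply/esym.
  by apply: product_measure_unique => // ? ? ? ?/=; rewrite product_measure2E.
by rewrite fubini_tonelli1//; exact: measurableT_comp.
Qed.

Definition addZ_Rn n (x : Rn R n) (b : R) (y : Rn R n) : Rn R n :=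
  [tuple (tnth x i + b * tnth y i)%R | i < n].

Lemma measurable_addZ_Rn n (x : Rn R n) (b : R) :
  measurable_fun setT (addZ_Rn x b).
Proof.
apply/measurable_fun_tnthP => i; rewrite /comp/=.
under eq_fun do rewrite tnth_mktuple.
apply: measurable_funD => //; apply: measurable_funM => //.
exact: measurable_tnth.
Qed.

Lemma addZ_cons n (x : Rn R n.+1) b t (y : Rn R n) :
  addZ_Rn x b (cons_Rn (t, y)) =
  cons_Rn ((thead x + b * t)%R, addZ_Rn [tuple of behead x] b y).
Proof.
apply: eq_from_tnth => i; rewrite tnth_mktuple /cons_Rn/=.
case: (unliftP ord0 i) => [j|] ->; last by rewrite !tnth0.
by rewrite !tnthS tnth_mktuple {1}(tuple_eta x) tnthS.
Qed.

(** The Jacobian of y |-> x + b y is |b|^n; by induction on n, one coordinate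
    at a time. *)
Lemma ge0_integral_addZ n (x : Rn R n) (b : R) (f : Rn R n -> \bar R) :
  b != 0%R -> measurable_fun setT f -> (forall y, 0 <= f y) ->
  \int[@leb n]_y f y = (`|b| ^+ n)%:E * \int[@leb n]_y f (addZ_Rn x b y).
Proof.
move=> b0; elim: n x f => [|n IHn] x f mf f0.
  rewrite expr0 mul1e; apply: eq_integral => y _; congr f.
  by apply: eq_from_tnth; case.
rewrite /leb ge0_integral_cons// ge0_integral_cons//; last first.
  by apply: measurableT_comp => //; exact: measurable_addZ_Rn.
rewrite (ge0_integral_affine (thead x) b0); first last.
- by move=> t; exact: integral_ge0.
- apply: (measurable_fun_fubini_tonelli_F (f \o @cons_Rn R n)) => //=.
  by apply: measurableT_comp => //; exact: measurable_cons_Rn.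
rewrite exprS EFinM -muleA; congr (_ * _).
rewrite -ge0_integralZl//; first last.
- by move=> t _; exact: integral_ge0.
- apply: (measurable_fun_fubini_tonelli_F
    (fun z => f (addZ_Rn x b (cons_Rn z)))) => //=.
  apply: measurableT_comp => //; apply: measurableT_comp.
    exact: measurable_addZ_Rn.
  exact: measurable_cons_Rn.
apply: eq_integral => t _.
rewrite (IHn [tuple of behead x])//; last first.
  apply: measurableT_comp => //.
  by apply: (measurableT_comp (@measurable_cons_Rn R n)); exact: pair1_measurable.
by congr (_ * _); apply: eq_integral => y _; rewrite addZ_cons.
Qed.

End lebesgue_Rn.

(** * Integration along the lines through a point *)

Section pencil.
Variables (R : realType) (n : nat) (x : Rn R n.+1).
Local Notation mu := (@lebesgue_measure R).
Local Notation lebn := (@leb R n).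

(** The lines through x in the directions (1, eta) cover almost all of R^(n+1);
    t is the increment of the first coordinate. *)
Definition ray (t : R) (eta : Rn R n) : Rn R n.+1 :=
  addZ_Rn x t (cons_Rn ((1 : R), eta)).

Lemma measurable_ray d (T : measurableType d) (g : T -> R) (h : T -> Rn R n) :
  measurable_fun setT g -> measurable_fun setT h ->
  measurable_fun setT (fun z => ray (g z) (h z)).
Proof.
move=> mg mh; apply/measurable_fun_tnthP => i; rewrite /comp/=.
under eq_fun do rewrite tnth_mktuple.
apply: measurable_funD => //; apply: measurable_funM => //.
apply: (measurableT_comp (@measurable_tnth _ _ _ i)).
apply: (measurableT_comp (@measurable_cons_Rn R n)).
exact: measurable_fun_pair.
Qed.

(** The integrand of f in the coordinates (t, eta), folded onto t > 0; the
    factor t^n is the Jacobian of eta |-> t eta. *)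
Definition pencil (f : Rn R n.+1 -> R) (z : measurableTypeR R * Rn R n) : R :=
  if 0 < z.1 then z.1 ^+ n * (f (ray z.1 z.2) + f (ray (- z.1) z.2)) else 0.

Lemma measurable_pencil f : measurable_fun setT f -> measurable_fun setT (pencil f).
Proof.
move=> mf; apply: measurable_fun_ifT => //.
  exact: measurable_fun_ltr.
apply: measurable_funM; first exact: measurable_funX.
apply: measurable_funD.
- by apply: (measurableT_comp mf); exact: measurable_ray.
- by apply: (measurableT_comp mf); apply: measurable_ray => //; exact: measurableT_comp.
Qed.

Lemma pencil_ge0 f : (forall y, 0 <= f y) -> forall z, 0 <= pencil f z.
Proof.
move=> f0 z; rewrite /pencil; case: ifP => // z0.
by rewrite mulr_ge0// ?addr_ge0// exprn_ge0// ltW.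
Qed.

Lemma norm_pencil f z : `|pencil f z| <= pencil (fun y => `|f y|) z.
Proof.
rewrite /pencil; case: ifPn => [z0|]; last by rewrite normr0.
by rewrite normrM ger0_norm ?exprn_ge0 ?(ltW z0)// ler_wpM2l ?exprn_ge0 ?(ltW z0)// ler_normD.
Qed.

Local Open Scope ereal_scope.

(** For fixed first coordinate the change of variable is affine in the n other
    ones, so only Tonelli's theorem and [ge0_integral_addZ] are needed. *)
Lemma ge0_integral_pencil (f : Rn R n.+1 -> R) :
  measurable_fun setT f -> (forall y, (0 <= f y)%R) ->
  \int[lebesgue_measure_Rn R n.+1]_y (f y)%:E =
  \int[mu \x lebn]_z (pencil f z)%:E.
Proof.
move=> mf f0.
have mEf : measurable_fun setT (EFin \o f) by exact/measurable_EFinP.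
have mPsi : measurable_fun [set: R]
    (fun t => \int[lebn]_y (f (cons_Rn (t, y)))%:E).
  apply: (measurable_fun_fubini_tonelli_F
    ((EFin \o f) \o @cons_Rn R n)) => //=; last first.
    by move=> z; rewrite lee_fin.
  by apply: measurableT_comp => //; exact: measurable_cons_Rn.
rewrite (ge0_integral_cons mEf)//=.
have Psi0 t : 0 <= \int[lebn]_y (f (cons_Rn (t, y)))%:E.
  by apply: integral_ge0 => y _; rewrite lee_fin.
rewrite (@ge0_integral_affine R (thead x) 1)//.
rewrite normr1 mul1e ge0_integral_symm//; last first.
  by apply: (measurableT_comp mPsi); exact: measurable_affine.
rewrite fubini_tonelli1//; first last.
- by move=> z; rewrite lee_fin pencil_ge0.
- by apply/measurable_EFinP; exact: measurable_pencil.
rewrite integral_mkcond; apply: eq_integral => t _.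
rewrite patchE; case: ifPn => [|]; rewrite /fubini_F.
  rewrite inE/= in_itv/= andbT => t0.
  have step (r : R) : (r != 0)%R ->
      \int[lebn]_y (f (cons_Rn ((thead x + 1 * r)%R, y)))%:E =
      (`|r| ^+ n)%:E * \int[lebn]_y (f (ray r y))%:E.
    move=> r0; rewrite (@ge0_integral_addZ R n [tuple of behead x] r)//.
    - congr (_ * _); apply: eq_integral => y _.
      by rewrite /ray addZ_cons mul1r mulr1.
    - apply: (measurableT_comp mEf); apply: (measurableT_comp (@measurable_cons_Rn R n)).
      exact: pair1_measurable.
    - by move=> y; rewrite lee_fin.
  have mr (r : R) : measurable_fun setT (fun y => (f (ray r y))%:E).
    apply: (measurableT_comp mEf).
    exact: measurable_ray.
  rewrite step ?gt_eqF// step ?oppr_eq0 ?gt_eqF// normrN gtr0_norm//.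
  rewrite -ge0_muleDr ?integral_ge0//; try by move=> y _; rewrite lee_fin.
  rewrite -ge0_integralD//; try by move=> y _; rewrite lee_fin.
  rewrite -ge0_integralZl//=; first last.
  - by rewrite lee_fin exprn_ge0// ltW.
  - by move=> y _; rewrite adde_ge0// lee_fin.
  - exact: emeasurable_funD.
  by apply: eq_integral => y _; rewrite /pencil/= t0.
rewrite notin_setE/= in_itv/= andbT => /negP/negbTE t0.
by rewrite integral0_eq// => y _; rewrite /pencil/= t0.
Qed.

Lemma integral_pencil (f : Rn R n.+1 -> R) :
  (lebesgue_measure_Rn R n.+1).-integrable setT (EFin \o f) ->
  (mu \x lebn).-integrable setT (EFin \o pencil f) /\
  \int[lebesgue_measure_Rn R n.+1]_y (f y)%:E =
  \int[mu \x lebn]_z (pencil f z)%:E.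
Proof.
have base (g : Rn R n.+1 -> R) :
    (lebesgue_measure_Rn R n.+1).-integrable setT (EFin \o g) ->
    (mu \x lebn).-integrable setT (EFin \o pencil g).
  move=> /integrableP[mg ig]; have mg' : measurable_fun setT g by exact/measurable_EFinP.
  apply/integrableP; split.
    by apply/measurable_EFinP; exact: measurable_pencil.
  move: ig; under eq_integral do rewrite /= -/(EFin _).
  rewrite ge0_integral_pencil//; last exact: measurableT_comp.
  apply: le_lt_trans; apply: ge0_le_integral => //.
  - apply: measurableT_comp => //.
    by apply/measurable_EFinP; exact: measurable_pencil.
  - apply/measurable_EFinP; apply: measurable_pencil; exact: measurableT_comp.
  - by move=> z _; rewrite lee_fin norm_pencil.
move=> intf; split; first exact: base.
have mf : measurable_fun setT f by move: intf => /measurable_int/measurable_EFinP.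
have posneg y : f y = ((f^\+)%R y - (f^\-)%R y)%R.
  by rewrite -[in LHS](funrposBneg f).
have intp := integrable_funrpos measurableT intf.
have intn := integrable_funrneg measurableT intf.
have -> : (fun z => (pencil f z)%:E) =
    (EFin \o pencil (f^\+)%R) \- (EFin \o pencil (f^\-)%R).
  apply/funext => z /=; rewrite -EFinB; congr EFin.
  rewrite /pencil; case: ifP => _; last by rewrite subrr.
  by rewrite !posneg -mulrBr; congr (_ * _)%R; ring.
rewrite integralB//; try exact: base.
rewrite -!ge0_integral_pencil//; try exact: measurable_funrpos;
  try exact: measurable_funrneg.
rewrite -integralB//.
apply: eq_integral => y _ /=; rewrite -EFinB; congr EFin.
exact: posneg.
Qed.

End pencil.

(** * The weight carried by a line *)

Section weight.
Variables (R : realType) (n : nat).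
Local Notation mu := (@lebesgue_measure R).
Local Notation lebn := (@leb R n).

(** The length of the direction (1, eta), by which t has to be multiplied to
    give the distance to x. *)
Definition speed (eta : Rn R n) : R := enorm (cons_Rn ((1 : R), eta)).

Lemma norm_tnth_enorm m (y : Rn R m) i : `|tnth y i| <= enorm y.
Proof.
rewrite /enorm -sqrtr_sqr ler_wsqrtr// (bigD1 i)//= lerDl.
by apply: sumr_ge0 => j _; exact: sqr_ge0.
Qed.

Lemma speed_ge1 eta : 1 <= speed eta.
Proof.
by have := norm_tnth_enorm (cons_Rn ((1 : R), eta)) ord0; rewrite tnth0 normr1.
Qed.

Lemma speed_gt0 eta : 0 < speed eta.
Proof. exact: lt_le_trans (speed_ge1 eta). Qed.

Lemma measurable_enorm m : measurable_fun setT (@enorm R m).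
Proof.
apply: (@measurableT_comp _ _ _ _ _ _ (@Num.sqrt R)).
  by apply: continuous_measurable_fun; exact: sqrt_continuous.
apply: measurable_sum => i; apply: measurable_funX; exact: measurable_tnth.
Qed.

Lemma measurable_speed : measurable_fun setT speed.
Proof.
apply: (measurableT_comp (@measurable_enorm n.+1)).
apply: (measurableT_comp (@measurable_cons_Rn R n)).
exact: measurable_fun_pair.
Qed.

Lemma enorm_addZ m (x y : Rn R m) t : Defs.edist x (addZ_Rn x t y) = `|t| * enorm y.
Proof.
rewrite /Defs.edist /enorm -sqrtr_sqr -sqrtrM ?sqr_ge0//; congr Num.sqrt.
rewrite mulr_sumr; apply: eq_bigr => i _; rewrite tnth_mktuple; ring.
Qed.

Lemma edist_ray (x : Rn R n.+1) t eta : Defs.edist x (ray x t eta) = `|t| * speed eta.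
Proof. exact: enorm_addZ. Qed.

Lemma measurable_weight :
  measurable_fun setT (fun eta => ((speed eta)^-1 ^+ n.+1)%:E).
Proof.
apply/measurable_EFinP; apply: measurable_funX.
under eq_fun do rewrite -powR_inv1 ?(ltW (speed_gt0 _))//.
by apply: (measurableT_comp (measurable_powR _)); exact: measurable_speed.
Qed.

Local Open Scope ereal_scope.

(** Integrating in the coordinates (t, eta) the indicator of a cube, which
    contains the ball |t| speed eta <= 1, gives at least a multiple of the left
    side; and the cube has finite measure. *)
Lemma weight_lty : \int[lebn]_eta ((speed eta)^-1 ^+ n.+1)%:E < +oo.
Proof.
pose x : Rn R n.+1 := [tuple 0%R | i < n.+1].
pose f : Rn R n.+1 -> R := \1_(@cube R n.+1 1).
have mcube := @measurable_cube R n.+1 1.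
have mf : measurable_fun setT f by exact: measurable_indic.
have f0 y : (0 <= f y)%R by rewrite /f indicE.
have fray t eta : (`|t| <= (speed eta)^-1)%R -> f (ray x t eta) = 1%R.
  move=> tl; rewrite /f indicE mem_set// => i /=.
  rewrite in_itv/= -ler_norml tnth_mktuple /x tnth_mktuple add0r normrM.
  rewrite (le_trans (ler_pM _ _ tl (norm_tnth_enorm _ _)))//.
  by rewrite mulVf// gt_eqF// speed_gt0.
have key eta : ((2^-1 * (speed eta)^-1) ^+ n.+1)%:E <=
    \int[mu]_t (pencil x f (t, eta))%:E.
  have l0 : (0 < (speed eta)^-1)%R by rewrite invr_gt0 speed_gt0.
  set l := (speed eta)^-1%R in fray l0 *.
  (* Here t^n is at least (l / 2)^n, so no integral has to be computed. *)
  pose D : set (measurableTypeR R) := `[(2^-1 * l)%R, l]%classic.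
  have mD : measurable D by exact: measurable_itv.
  have mc : measurable_fun setT (fun t => (pencil x f (t, eta))%:E).
    apply/measurable_EFinP.
    by apply: (measurableT_comp (measurable_pencil x mf)); exact: pair2_measurable.
  apply: (@le_trans _ _ (\int[mu]_(t in D) (pencil x f (t, eta))%:E)); last first.
    by apply: ge0_subset_integral => // t _; rewrite lee_fin pencil_ge0.
  apply: (@le_trans _ _ (\int[mu]_(t in D) ((2^-1 * l) ^+ n)%:E)).
    have muD : mu D = (l - 2^-1 * l)%:E.
      have := @lebesgue_measure_itv R `[(2^-1 * l)%R, l].
      by rewrite /= lte_fin ifT//; lra.
    rewrite integral_cst//= muD -EFinM lee_fin exprSr ler_wpM2l ?exprn_ge0
      ?mulr_ge0 ?(ltW l0)//.
    by lra.
  apply: ge0_le_integral => //.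
  - by move=> t _; rewrite lee_fin exprn_ge0// mulr_ge0// ltW.
  - exact: measurable_funTS.
  - move=> t; rewrite /D/= in_itv/= => /andP[lt tl].
    have t0 : (0 < t)%R by lra.
    rewrite lee_fin /pencil/= t0 !fray ?normrN ?gtr0_norm//.
    have : ((2^-1 * l) ^+ n <= t ^+ n)%R.
      by rewrite lerXn2r// nnegrE ?mulr_ge0// ltW.
    have := exprn_ge0 n (ltW t0); lra.
have : \int[lebn]_eta ((2^-1 * (speed eta)^-1) ^+ n.+1)%:E < +oo.
  apply: le_lt_trans (@lebesgue_cube_lty R n.+1 1).
  rewrite -(setIT (cube 1)) -integral_indic// (ge0_integral_pencil x)//.
  rewrite fubini_tonelli2//; first last.
  - by move=> z; rewrite lee_fin pencil_ge0.
  - by apply/measurable_EFinP; exact: measurable_pencil.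
  apply: ge0_le_integral => //.
  - move=> eta _; rewrite lee_fin exprn_ge0// mulr_ge0// invr_ge0.
    exact: ltW (speed_gt0 _).
  - under eq_fun do rewrite exprMn EFinM.
    by apply: measurable_funeM; exact: measurable_weight.
  - apply: (measurable_fun_fubini_tonelli_G (EFin \o pencil x f)) => //=.
    + by apply/measurable_EFinP; exact: measurable_pencil.
    + by move=> z; rewrite lee_fin pencil_ge0.
under eq_integral do rewrite exprMn EFinM.
rewrite ge0_integralZl//; first last.
- by move=> eta _; rewrite lee_fin exprn_ge0// invr_ge0 (ltW (speed_gt0 _)).
- exact: measurable_weight.
apply: contraTT; rewrite -!leNgt !leye_eq => /eqP ->.
by rewrite gt0_muley// lte_fin exprn_gt0.
Qed.

Definition total_weight : R :=
  fine (\int[lebn]_eta ((speed eta)^-1 ^+ n.+1)%:E).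

Lemma total_weightE :
  (total_weight)%:E = \int[lebn]_eta ((speed eta)^-1 ^+ n.+1)%:E.
Proof.
rewrite fineK// ge0_fin_numE ?weight_lty//.
apply: integral_ge0 => eta _.
by rewrite lee_fin exprn_ge0// invr_ge0 (ltW (speed_gt0 _)).
Qed.

Lemma total_weight_ge0 : (0 <= total_weight)%R.
Proof.
rewrite -lee_fin total_weightE; apply: integral_ge0 => eta _.
by rewrite lee_fin exprn_ge0// invr_ge0 (ltW (speed_gt0 _)).
Qed.

Lemma ge0_integral_le_weight x (f : Rn R n.+1 -> R) (C : R) :
  measurable_fun setT f -> (forall y, (0 <= f y)%R) -> (0 <= C)%R ->
  (forall eta, \int[mu]_t (pencil x f (t, eta))%:E <=
    (C * (speed eta)^-1 ^+ n.+1)%:E) ->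
  \int[lebesgue_measure_Rn R n.+1]_y (f y)%:E <= (C * total_weight)%:E.
Proof.
move=> mf f0 C0 H; rewrite (ge0_integral_pencil x)//.
rewrite EFinM total_weightE fubini_tonelli2//; first last.
- by move=> z; rewrite lee_fin pencil_ge0.
- by apply/measurable_EFinP; exact: measurable_pencil.
rewrite -ge0_integralZl//; first last.
- by move=> eta _; rewrite lee_fin exprn_ge0// invr_ge0 (ltW (speed_gt0 _)).
- exact: measurable_weight.
apply: ge0_le_integral => //.
- by move=> eta _; apply: integral_ge0 => t _; rewrite lee_fin pencil_ge0.
- apply: (measurable_fun_fubini_tonelli_G (EFin \o pencil x f)) => //=.
  + by apply/measurable_EFinP; exact: measurable_pencil.
  + by move=> z; rewrite lee_fin pencil_ge0.
- by apply: measurable_funeM; exact: measurable_weight.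
- by move=> eta _; rewrite -EFinM; exact: H.
Qed.

(** The form in which the reduction to lines is used: a bound on all line
    integrals by the right power of the speed bounds the integral over R^n. *)
Lemma integral_le_weight x (f : Rn R n.+1 -> R) (C : R) :
  (lebesgue_measure_Rn R n.+1).-integrable setT (EFin \o f) -> (0 <= C)%R ->
  (forall eta, `|\int[mu]_t (pencil x f (t, eta))%:E| <=
    (C * (speed eta)^-1 ^+ n.+1)%:E) ->
  `|\int[lebesgue_measure_Rn R n.+1]_y (f y)%:E| <= (C * total_weight)%:E.
Proof.
move=> intf C0 H; have [intc ->] := integral_pencil x intf.
rewrite -integral21_prod_meas1//.
have mG := measurable_fubini_G intc.
apply: (le_trans (le_abse_integral _ _ _)) => //.
rewrite EFinM total_weightE -ge0_integralZl//; first last.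
- by move=> eta _; rewrite lee_fin exprn_ge0// invr_ge0 (ltW (speed_gt0 _)).
- exact: measurable_weight.
apply: ge0_le_integral => //.
- exact: measurableT_comp.
- by apply: measurable_funeM; exact: measurable_weight.
- by move=> eta _; rewrite -EFinM; exact: H.
Qed.

End weight.

(** * Inequalities for real powers *)

Section powers.
Variable R : realType.
Implicit Types (x y r s q : R).

Lemma powRDp x r s : 0 < x -> x `^ (r + s) = x `^ r * x `^ s.
Proof. by move=> x0; rewrite powRD// (lt0r_neq0 x0) implybT. Qed.

Lemma powR_subadd s x y : 0 <= s -> s <= 1 -> 0 <= x -> 0 <= y ->
  (x + y) `^ s <= x `^ s + y `^ s.
Proof.
move=> s0 s1; rewrite le_eqVlt => /predU1P[<- _|x0].
  by rewrite add0r lerDr powR_ge0.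
rewrite le_eqVlt => /predU1P[<-|y0]; first by rewrite addr0 lerDl powR_ge0.
have w0 : 0 < x + y by exact: addr_gt0.
have part z : 0 < z -> z <= x + y -> (x + y) `^ s * (z / (x + y)) <= z `^ s.
  move=> z0 zw; rewrite -[in leRHS](divfK (lt0r_neq0 w0) z) powRM ?(ltW w0)//; last first.
    by rewrite divr_ge0// ltW.
  rewrite mulrC ler_wpM2r ?powR_ge0// ger1_powR// divr_gt0//= ler_pdivrMr//.
  by rewrite mul1r.
have -> : (x + y) `^ s = (x + y) `^ s * (x / (x + y)) + (x + y) `^ s * (y / (x + y)).
  by rewrite -mulrDr -mulrDl divff ?mulr1// gt_eqF.
by apply: lerD; apply: part => //; lra.
Qed.

(** The profile is only Hoelder continuous at the ends of a chord; this exact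
    form, with constant 1, also controls a^s - z^s by |a - z|^s uniformly in a
    and makes rescaling unnecessary. *)
Lemma powR_holder s x y : 0 <= s -> s <= 1 -> 0 <= x -> 0 <= y ->
  `|x `^ s - y `^ s| <= `|x - y| `^ s.
Proof.
move=> s0 s1; wlog xy : x y / y <= x => [wl x0 y0|x0 y0].
  have [/wl|/ltW/wl] := leP y x; first exact.
  by rewrite distrC (distrC x); exact.
rewrite ger0_norm ?subr_ge0 ?ge0_ler_powR ?nnegrE//.
rewrite (ger0_norm (_ : 0 <= x - y)) ?subr_ge0//.
rewrite lerBlDr; have := @powR_subadd s (x - y) y s0 s1.
by rewrite subrK; apply => //; rewrite subr_ge0.
Qed.

Lemma powR_MVT r x y : 0 < x -> x < y ->
  exists2 c, x <= c <= y & y `^ r - x `^ r = r * c `^ (r - 1) * (y - x).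
Proof.
move=> x0 xy.
have [] := @MVT_segment R (fun z => z `^ r) (fun z => r * z `^ (r - 1)) x y (ltW xy).
- by move=> z; rewrite in_itv/= => /andP[xz _]; apply: is_derive1_powR; exact: lt_trans xz.
- apply: derivable_within_continuous => z; rewrite in_itv/= => /andP[xz _].
  by apply: derivable_powR; rewrite in_itv/= andbT (lt_le_trans x0).
- by move=> c; rewrite in_itv/= => xcy ->; exists c.
Qed.

(** Away from 0 every power r <= 1 is Lipschitz, the derivative being largest
    at the left end. *)
Lemma powR_lip_ge r m x y : r <= 1 -> 0 < m -> m <= x -> m <= y ->
  `|x `^ r - y `^ r| <= `|r| * m `^ (r - 1) * `|x - y|.
Proof.
move=> r1 m0; wlog xy : x y / x < y => [wl mx my|mx my].
  have [xy|yx|->] := ltgtP x y; first exact: wl.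
    by rewrite distrC (distrC x); exact: wl.
  by rewrite !subrr normr0 mulr0.
have x0 := lt_le_trans m0 mx.
have [c /andP[xc cy]] := powR_MVT r x0 xy.
rewrite distrC => ->; rewrite !normrM (distrC x) -!mulrA ler_wpM2l// ler_wpM2r//.
rewrite ger0_norm ?powR_ge0// -opprB !powRN lef_pV2 ?posrE ?powR_gt0//; last first.
  exact: lt_le_trans xc.
rewrite ge0_ler_powR ?nnegrE ?subr_ge0//; lra.
Qed.

Lemma powR_lip_le q M x y : 1 <= q -> 0 <= x <= M -> 0 <= y <= M ->
  `|x `^ q - y `^ q| <= q * M `^ (q - 1) * `|x - y|.
Proof.
move=> q1; have q0 : 0 < q by lra.
wlog xy : x y / x < y => [wl mx my|/andP[x0 xM] /andP[y0 yM]].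
  have [xy|yx|->] := ltgtP x y; first exact: wl.
    by rewrite distrC (distrC x); exact: wl.
  by rewrite !subrr normr0 mulr0.
have M0 : 0 <= M := le_trans x0 xM.
move: x0; rewrite le_eqVlt => /predU1P[x0|x0].
  rewrite -x0 powR0 ?gt_eqF// !sub0r !normrN ger0_norm ?powR_ge0// ger0_norm//.
  rewrite -mulr_powRB1// mulrC ler_wpM2r//.
  rewrite -[leLHS]mul1r ler_pM ?powR_ge0//.
  by rewrite ge0_ler_powR ?nnegrE ?subr_ge0.
have [c /andP[xc cy]] := powR_MVT q x0 xy.
rewrite distrC => ->; rewrite !normrM (distrC x) -!mulrA ger0_norm ?(ltW q0)//.
rewrite ler_wpM2l ?(ltW q0)// ler_wpM2r//.
rewrite ger0_norm ?powR_ge0// ge0_ler_powR ?nnegrE ?subr_ge0//; last lra.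
by rewrite ltW// (lt_le_trans x0).
Qed.

(** The odd power of exponent q - 1, through which the p-Laplacian depends on
    increments. *)
Definition spow q x : R := `|x| `^ (q - 2) * x.

Lemma spowN q x : spow q (- x) = - spow q x.
Proof. by rewrite /spow normrN mulrN. Qed.

Lemma spowM q x y : spow q (x * y) = spow q x * spow q y.
Proof. by rewrite /spow normrM powRM//; ring. Qed.

Lemma spow_ge0E q x : 1 < q -> 0 <= x -> spow q x = x `^ (q - 1).
Proof.
move=> q1 x0; rewrite /spow ger0_norm// mulrC -[RHS]mulr_powRB1// ?subr_gt0//.
by congr (_ * _ `^ _); ring.
Qed.

Lemma norm_spow q x : 1 < q -> `|spow q x| = `|x| `^ (q - 1).
Proof.
move=> q1; rewrite -spow_ge0E// /spow normrM normr_id; congr (_ * _).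
by rewrite ger0_norm ?powR_ge0.
Qed.

(** This is where the exponent is at least 2: the odd power is then locally
    Lipschitz through 0. *)
Lemma spow_lip q M x y : 2 <= q -> `|x| <= M -> `|y| <= M ->
  `|spow q x - spow q y| <= (q - 1) * M `^ (q - 2) * `|x - y|.
Proof.
move=> q2; wlog x0 : x y / 0 <= x => [wl xM yM|].
  have [/wl|/ltW x0] := leP 0 x; first exact.
  have := wl (- x) (- y); rewrite !spowN !normrN -!opprD !normrN; apply => //.
  by rewrite oppr_ge0.
have q1 : 1 < q by lra.
rewrite (ger0_norm x0) => xM yM.
have M0 : 0 <= M := le_trans x0 xM.
have [y0|/ltW y0] := leP 0 y.
  rewrite !spow_ge0E//; have := @powR_lip_le (q - 1) M x y.
  have -> : q - 1 - 1 = q - 2 by ring.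
  apply; rewrite ?x0 ?y0//; first lra.
  by rewrite -(ger0_norm y0).
have [z yz] : exists z, y = - z by exists (- y); rewrite opprK.
move: y0 yM; rewrite {}yz oppr_le0 normrN => z0; rewrite (ger0_norm z0) => zM.
rewrite spowN !opprK !spow_ge0E//.
rewrite !ger0_norm ?addr_ge0 ?powR_ge0//.
have le w : 0 <= w <= M -> w `^ (q - 1) <= M `^ (q - 2) * w.
  move=> /andP[w0 wM]; rewrite -mulr_powRB1 ?subr_gt0//.
  have -> : q - 1 - 1 = q - 2 by ring.
  by rewrite mulrC ler_wpM2r// ge0_ler_powR ?nnegrE// subr_ge0.
apply: (@le_trans _ _ (M `^ (q - 2) * (x + z))).
  by rewrite mulrDr; apply: lerD; apply: le; rewrite ?x0 ?xM ?z0.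
rewrite -mulrA ler_peMl//; last lra.
by rewrite mulr_ge0 ?powR_ge0// addr_ge0.
Qed.

Definition pos x : R := Num.max 0 x.

Lemma pos_ge0 x : 0 <= pos x.
Proof. by rewrite /pos le_max lexx. Qed.

Lemma posE x : 0 <= x -> pos x = x.
Proof. by move=> x0; rewrite /pos; apply/max_idPr. Qed.

Lemma pos0 x : x <= 0 -> pos x = 0.
Proof. by move=> x0; rewrite /pos; apply/max_idPl. Qed.

Lemma posM k x : 0 <= k -> pos (k * x) = k * pos x.
Proof.
move=> k0; have [x0|/ltW x0] := leP 0 x; first by rewrite !posE// mulr_ge0.
by rewrite !pos0 ?mulr0// mulr_ge0_le0.
Qed.

Lemma pos_lip x y : `|pos x - pos y| <= `|x - y|.
Proof.
wlog xy : x y / x <= y => [wl|].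
  have [/wl//|/ltW/wl] := leP x y.
  by rewrite distrC (distrC x).
rewrite (distrC (pos x)) (distrC x) (ger0_norm (_ : 0 <= y - x)) ?subr_ge0//.
have [x0|/ltW x0] := leP 0 x.
  by rewrite !posE ?(le_trans x0)// ger0_norm ?subr_ge0.
rewrite (pos0 x0) subr0 ger0_norm ?pos_ge0//.
have [y0|/ltW y0] := leP 0 y; first by rewrite posE//; lra.
by rewrite pos0//; lra.
Qed.

Lemma continuous_pos_powR s : 0 < s -> s <= 1 ->
  continuous (fun x : R => pos x `^ s).
Proof.
move=> s0 s1 x; apply/cvgrPdist_lt => e e0.
near=> y.
apply: (le_lt_trans (powR_holder (ltW s0) s1 (pos_ge0 _) (pos_ge0 _))).
apply: (@le_lt_trans _ _ (`|x - y| `^ s)).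
  by rewrite ge0_ler_powR ?nnegrE ?(ltW s0)// pos_lip.
have -> : e = (e `^ s^-1) `^ s by rewrite -powRrM mulVf ?gt_eqF// powRr1 ?ltW.
rewrite gt0_ltr_powR ?nnegrE ?powR_ge0//.
near: y; apply: cvgr_dist_lt; first exact: cvg_id.
by rewrite powR_gt0.
Unshelve. all: by end_near. Qed.

Lemma measurable_pos_powR s : measurable_fun setT (fun x : R => pos x `^ s).
Proof.
apply: (measurableT_comp (measurable_powR s)).
by apply: (@measurable_maxr _ _ _ setT (cst (0 : R)) id).
Qed.

Lemma measurable_spow q : measurable_fun setT (spow q : R -> R).
Proof.
apply: measurable_funM => //; apply: (measurableT_comp (measurable_powR _)).
exact: normr_measurable.
Qed.

End powers.

(** * Integrals of powers near zero and at infinity *)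

Section tails.
Variable R : realType.
Local Notation mu := (@lebesgue_measure R).

Lemma continuous_powR_gt0 (r x : R) : 0 < x -> {for x, continuous (fun z : R => z `^ r)}.
Proof.
move=> x0; apply: differentiable_continuous; apply/derivable1_diffP.
by apply: derivable_powR; rewrite in_itv/= andbT.
Qed.

Lemma powR_cvgy0 (r : R) : 0 < r -> t `^ (- r) @[t --> +oo] --> (0 : R).
Proof.
move=> r0; apply/cvgrPdist_lt => e e0; near=> t.
have t0 : 0 < t by near: t; exact: nbhs_pinfty_gt.
rewrite sub0r normrN ger0_norm ?powR_ge0//.
have -> : e = (e `^ (- r^-1)) `^ (- r).
  by rewrite -powRrM mulrNN mulVf ?gt_eqF// powRr1 ?ltW.
rewrite !(powRN _ r) ltf_pV2 ?posrE ?powR_gt0// gt0_ltr_powR ?nnegrE ?powR_ge0// ?(ltW t0)//.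
Unshelve. all: by end_near. Qed.

Lemma is_derive_cpowR (c r t : R) : 0 < t ->
  is_derive t 1 (fun z => c * z `^ r) (c * (r * t `^ (r - 1))).
Proof. by move=> t0; exact: (is_deriveZ c (is_derive1_powR r t0)). Qed.

Lemma is_derive_continuous (f : R -> R) (t df : R) :
  is_derive t 1 f df -> {for t, continuous f}.
Proof.
by move=> [d _]; apply: differentiable_continuous; exact/derivable1_diffP.
Qed.

Lemma continuous_within_gt0_itvcy (f : R -> R) (e : R) : 0 < e ->
  (forall t, 0 < t -> {for t, continuous f}) -> {within `[e, +oo[, continuous f}.
Proof.
move=> e0 cf; apply/continuous_within_itvcyP; split.
  by move=> t; rewrite in_itv/= andbT => et; apply: cf; exact: lt_trans et.
by apply: cvg_at_right_filter; exact: cf.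
Qed.

Lemma continuous_within_gt0_itvcc (f : R -> R) (e u : R) : 0 < e -> e < u ->
  (forall t, 0 < t -> {for t, continuous f}) -> {within `[e, u], continuous f}.
Proof.
move=> e0 eu cf; apply/continuous_within_itvP => //; split.
- by move=> t; rewrite in_itv/= => /andP[et _]; apply: cf; exact: lt_trans et.
- by apply: cvg_at_right_filter; exact: cf.
- by apply: cvg_at_left_filter; apply: cf; exact: lt_trans eu.
Qed.

Lemma measurable_fun_gt0 (f : R -> R) (D : set (measurableTypeR R)) :
  (forall t, 0 < t -> {for t, continuous f}) -> measurable D ->
  D `<=` [set t | 0 < t] -> measurable_fun (D : set R) f.
Proof.
move=> cf mD D0.
have mE : measurable_fun (`]0, +oo[%classic : set R) f.
  apply: open_continuous_measurable_fun; first exact: interval_open.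
  by move=> t; rewrite inE/= in_itv/= andbT; exact: cf.
apply: measurable_funS mE => //.
by move=> t /D0; rewrite /= in_itv/= andbT.
Qed.

(** The kernel is integrable at infinity for r = s and for r = s p. *)
Lemma integral_powR_tail (r e : R) : 0 < r -> 0 < e ->
  (\int[mu]_(t in `[e, +oo[) (t `^ (- (1 + r)))%:E = (e `^ (- r) / r)%:E)%E.
Proof.
move=> r0 e0.
pose F (t : R) := - r^-1 * t `^ (- r).
have dF (t : R) : 0 < t -> is_derive t 1 F (t `^ (- (1 + r))).
  move=> t0; apply: is_derive_eq; first exact: is_derive_cpowR.
  rewrite mulrA mulrNN mulVf ?gt_eqF// mul1r; congr (_ `^ _); ring.
rewrite (@ge0_continuous_FTC2y _ _ F _ 0).
- by rewrite sub0e /F -EFinN mulNr opprK mulrC.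
- by move=> t et; exact: powR_ge0.
- by apply: continuous_within_gt0_itvcy => // t; exact: continuous_powR_gt0.
- by rewrite -[X in _ --> X](mulr0 (- r^-1)); apply: cvgMr; exact: powR_cvgy0.
- by move=> t et; have [] := dF t (lt_trans e0 et).
- by apply: cvg_at_right_filter; apply: is_derive_continuous; exact: dF.
- move=> t; rewrite in_itv/= andbT => et.
  by rewrite derive1E; have [_] := dF t (lt_trans e0 et).
Qed.

Lemma integral_powR_near0 (r e u : R) : r < 1 -> 0 < e -> e < u ->
  (\int[mu]_(t in `[e, u]) (t `^ (- r))%:E <= (u `^ (1 - r) / (1 - r))%:E)%E.
Proof.
move=> r1 e0 eu.
have r1' : 0 < 1 - r by rewrite subr_gt0.
pose F (t : R) := (1 - r)^-1 * t `^ (1 - r).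
have dF (t : R) : 0 < t -> is_derive t 1 F (t `^ (- r)).
  move=> t0; apply: is_derive_eq; first exact: is_derive_cpowR.
  rewrite mulrA mulVf ?gt_eqF// mul1r; congr (_ `^ _); ring.
have cF t : 0 < t -> {for t, continuous F}.
  by move=> t0; apply: is_derive_continuous; exact: dF.
rewrite (@continuous_FTC2 _ _ F)//.
- rewrite -EFinB lee_fin /F ![(1 - r)^-1 * _]mulrC lerBlDr lerDl.
  by rewrite mulr_ge0 ?powR_ge0// invr_ge0 ltW.
- by apply: continuous_within_gt0_itvcc => // t; exact: continuous_powR_gt0.
- split.
  + move=> t; rewrite in_itv/= => /andP[et _].
    by have [] := dF t (lt_trans e0 et).
  + by apply: cvg_at_right_filter; exact: cF.
  + by apply: cvg_at_left_filter; apply: cF; exact: lt_trans eu.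
- move=> t; rewrite in_itv/= => /andP[et _].
  by rewrite derive1E; have [_] := dF t (lt_trans e0 et).
Qed.

End tails.

(** * The half-line: the power s of the positive part has zero fractional p-Laplacian *)

Section half_line.
Variables (R : realType) (s p a : R).
Hypotheses (s0 : 0 < s) (s1 : s < 1) (p2 : 2 < p) (a0 : 0 < a).
Local Notation mu := (@lebesgue_measure R).

Ltac hlra := move: s0 s1 p2 a0 => *; lra.

Let sp0 : 0 < s * p. Proof. by rewrite mulr_gt0//; hlra. Qed.

(** The contributions of z = a - t and of z = a + t to the fractional
    p-Laplacian of the s-th power of the positive part at the point a; the
    second one enters with a minus sign. *)
Definition half_left (t : R) : R :=
  (a `^ s - pos (a - t) `^ s) `^ (p - 1) * t `^ (- (1 + s * p)).

Definition half_right (t : R) : R :=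
  ((a + t) `^ s - a `^ s) `^ (p - 1) * t `^ (- (1 + s * p)).

Lemma half_left_ge0 t : 0 <= half_left t.
Proof. by rewrite mulr_ge0 ?powR_ge0. Qed.

Lemma half_right_ge0 t : 0 <= half_right t.
Proof. by rewrite mulr_ge0 ?powR_ge0. Qed.

(** Both contributions are at most t^(-1-s), because increments of z^s are at
    most t^s. *)
Lemma power_diff_le (d t : R) : 0 < t -> 0 <= d <= t `^ s ->
  d `^ (p - 1) * t `^ (- (1 + s * p)) <= t `^ (- (1 + s)).
Proof.
move=> t0 /andP[d0 dt].
have -> : t `^ (- (1 + s)) = (t `^ s) `^ (p - 1) * t `^ (- (1 + s * p)).
  by rewrite -powRrM -powRDp//; congr (_ `^ _); ring.
rewrite ler_wpM2r ?powR_ge0// ge0_ler_powR ?nnegrE ?powR_ge0//; hlra.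
Qed.

Let ub (x y : R) : 0 <= y -> y <= x -> 0 <= x `^ s - y `^ s <= (x - y) `^ s.
Proof.
move=> y0 yx; rewrite subr_ge0 ge0_ler_powR ?nnegrE ?(ltW s0) ?(le_trans y0)//=.
have := powR_holder (ltW s0) (ltW s1) (le_trans y0 yx) y0.
rewrite (ger0_norm (_ : 0 <= x - y)) ?subr_ge0//.
exact/le_trans/ler_norm.
Qed.

Let pos_le (t : R) : 0 < t -> pos (a - t) <= a.
Proof.
move=> t0; have [h|/ltW h] := leP 0 (a - t); first by rewrite posE//; hlra.
by rewrite pos0// ltW.
Qed.

Lemma half_left_le (t : R) : 0 < t -> half_left t <= t `^ (- (1 + s)).
Proof.
move=> t0; apply: power_diff_le => //.
have /andP[-> h] := ub (pos_ge0 (a - t)) (pos_le t0) => /=.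
apply: (le_trans h); rewrite ge0_ler_powR ?nnegrE ?(ltW s0)//.
- by rewrite subr_ge0 pos_le.
- exact: ltW.
- have [h'|/ltW h'] := leP 0 (a - t); first by rewrite posE//; hlra.
  by rewrite pos0//; hlra.
Qed.

Lemma half_right_le (t : R) : 0 < t -> half_right t <= t `^ (- (1 + s)).
Proof.
move=> t0; apply: power_diff_le => //.
have := @ub (a + t) a (ltW a0).
by rewrite [a + t - a]addrAC subrr add0r; apply; rewrite lerDl ltW.
Qed.

Let L_gt0 t : 0 < t -> 0 < a `^ s - pos (a - t) `^ s.
Proof.
move=> t0; rewrite subr_gt0 gt0_ltr_powR ?nnegrE ?pos_ge0 ?(ltW a0)//.
have [h|/ltW h] := leP 0 (a - t); first by rewrite posE//; hlra.
by rewrite pos0.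
Qed.

Let R_gt0 t : 0 < t -> 0 < (a + t) `^ s - a `^ s.
Proof.
by move=> t0; rewrite subr_gt0 gt0_ltr_powR ?nnegrE ?addr_ge0 ?ltW//; hlra.
Qed.

Lemma continuous_half_left (t : R) : 0 < t -> {for t, continuous half_left}.
Proof.
move=> t0; apply: (@continuousM _ _ _ _ t); last exact: continuous_powR_gt0.
apply: (@continuous_comp _ _ _ (fun t : R => a `^ s - pos (a - t) `^ s)
  (fun z : R => z `^ (p - 1))); last exact/continuous_powR_gt0/L_gt0.
apply: (@continuousB _ _ _ (cst (a `^ s)) (fun t : R => pos (a - t) `^ s) t).
  exact: cst_continuous.
apply: (@continuous_comp _ _ _ (fun t : R => a - t) (fun z : R => pos z `^ s)); last first.
  exact: continuous_pos_powR (ltW s1) _.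
by apply: (@continuousB _ _ _ (cst a) id t) => //; exact: cst_continuous.
Qed.

Let dshift (r t : R) : 0 < t ->
  is_derive t 1 (fun z => (a + z) `^ r) (r * (a + t) `^ (r - 1)).
Proof.
move=> t0; have at0 : 0 < a + t by rewrite addr_gt0.
rewrite -[X in is_derive _ _ _ X]mulr1.
apply: (@is_derive1_comp _ (fun z => z `^ r) (fun z => a + z)).
  exact: is_derive1_powR.
rewrite -[X in is_derive _ _ _ X]add0r.
by apply: (@is_deriveD _ _ _ (cst a) id).
Qed.

Let du (t : R) : 0 < t ->
  is_derive t 1 (fun z => (a + z) `^ s - a `^ s) (s * (a + t) `^ (s - 1)).
Proof.
move=> t0; rewrite -[X in is_derive _ _ _ X]subr0.
by apply: (@is_deriveB _ _ _ _ (cst (a `^ s))); exact: dshift.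
Qed.

Lemma continuous_half_right (t : R) : 0 < t -> {for t, continuous half_right}.
Proof.
move=> t0; apply: (@continuousM _ _ _ _ t); last exact: continuous_powR_gt0.
apply: (@continuous_comp _ _ _ (fun t : R => (a + t) `^ s - a `^ s)
  (fun z : R => z `^ (p - 1))); last exact/continuous_powR_gt0/R_gt0.
exact: is_derive_continuous (du t0).
Qed.

(** The inversion z -> a^2 / z sends a + t to a - mirror t. *)
Definition mirror (t : R) : R := a * t / (a + t).

Lemma mirrorE (t : R) : 0 < t -> a - mirror t = a * (a / (a + t)).
Proof. by move=> t0; rewrite /mirror; field; hlra. Qed.

Lemma is_derive_mirror (t : R) : 0 < t -> is_derive t 1 mirror ((a / (a + t)) ^+ 2).
Proof.
move=> t0.
have at0 : 0 < a + t by rewrite addr_gt0.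
apply: (@near_eq_is_derive _ _ _ (fun z => a - a ^+ 2 * (a + z) `^ (-1))).
  near=> z; have z0 : 0 < z by near: z; exact: lt_nbhsr.
  by rewrite powR_inv1 ?addr_ge0 ?ltW// /mirror; field; hlra.
have d := @is_deriveB _ _ _ (cst a) _ t 1 0 _ (is_derive_cst a t 1)
  (is_deriveZ (a ^+ 2) (dshift (-1) t0)).
apply: (is_derive_eq d).
rewrite sub0r -scalerN mulNr mul1r opprK /GRing.scale/=.
have -> : (-1 - 1 : R) = - 2%:R by ring.
by rewrite powR_invn ?ltW// expr_div_n.
Unshelve. all: by end_near. Qed.

(** This is |a^s - z^s|^p / |a - z|^(s p) at z = a + t, and it takes the same
    value at the mirror point, so that one formula serves on both sides. *)
Definition mirror_prim (t : R) : R :=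
  ((a + t) `^ s - a `^ s) `^ p * t `^ (- (s * p)).

(** The derivative isolates the factor by which inversion distorts the
    integrand, compare [half_left_mirror]: what inversion does not account for
    is an exact derivative. *)
Lemma is_derive_mirror_prim (t : R) : 0 < t ->
  is_derive t 1 mirror_prim
    (s * p * a `^ s * (half_right t - (a / (a + t)) `^ (1 - s) * half_right t)).
Proof.
move=> t0.
have at0 : 0 < a + t by rewrite addr_gt0.
have dup := @is_derive1_comp _ (fun z => z `^ p) _ t _ _
  (is_derive1_powR p (R_gt0 t0)) (du t0).
apply: is_derive_eq.
  exact: (is_deriveM dup (is_derive1_powR (- (s * p)) t0)).
rewrite /GRing.scale/= /half_right.
set u := (a + t) `^ s - a `^ s.
have u0 : 0 < u by exact: R_gt0.
have -> : u `^ p = u * u `^ (p - 1) by rewrite mulr_powRB1// ?ltW//; hlra.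
have -> : t `^ (- (s * p)) = t * t `^ (- (1 + s * p)).
  transitivity (t `^ 1 * t `^ (- (1 + s * p))); last by rewrite powRr1 ?ltW.
  by rewrite -powRDp//; congr (_ `^ _); ring.
have -> : - (s * p) - 1 = - (1 + s * p) by ring.
have -> : (a / (a + t)) `^ (1 - s) = a * (a `^ s)^-1 * (a + t) `^ (s - 1).
  rewrite powRM ?invr_ge0 ?ltW// -[(a + t)^-1]powR_inv1 ?ltW// -powRrM.
  rewrite (powRDp 1 (- s) a0) powRr1 ?ltW// powRN; congr (_ * _ `^ _); ring.
have uE : (a + t) `^ (s - 1) * t = u + a `^ s - a * (a + t) `^ (s - 1).
  rewrite /u -[in RHS](mulr_powRB1 (ltW at0) s0); ring.
have A0 : a `^ s != 0 by rewrite gt_eqF// powR_gt0.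
move: uE; set B := (a + t) `^ (s - 1); set T := t `^ _; set U := u `^ _.
set A := a `^ s in A0 *.
move=> uE.
have -> : u * U * (- (s * p) * T) + t * T * (p * U * (s * B)) =
    s * p * U * T * (B * t - u) by ring.
rewrite uE; field; exact: A0.
Qed.

Lemma half_left_mirror (t : R) : 0 < t ->
  half_left (mirror t) * (a / (a + t)) ^+ 2 = (a / (a + t)) `^ (1 - s) * half_right t.
Proof.
move=> t0.
have at0 : 0 < a + t by rewrite addr_gt0.
rewrite /half_left mirrorE// posE ?mulr_ge0 ?invr_ge0 ?ltW//.
set rho := a / (a + t).
have rho0 : 0 < rho by rewrite divr_gt0.
have mE : mirror t = rho * t by rewrite /mirror /rho; ring.
have -> : a `^ s - (a * rho) `^ s = rho `^ s * ((a + t) `^ s - a `^ s).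
  have ra : rho * (a + t) = a by rewrite /rho divfK// gt_eqF.
  by rewrite mulrBr -powRM ?ltW// ra -powRM ?ltW// (mulrC rho).
rewrite powRM ?powR_ge0 ?(ltW (R_gt0 t0))// mE powRM ?ltW// -powRrM /half_right.
set U := _ `^ (p - 1); set T := t `^ _.
rewrite -powR_mulrn ?ltW//.
have -> : rho `^ (1 - s) =
  rho `^ (s * (p - 1)) * rho `^ (- (1 + s * p)) * rho `^ 2%:R.
  by rewrite -!powRDp//; congr (_ `^ _); ring.
ring.
Qed.

Let mirror_gt0 (t : R) : 0 < t -> 0 < mirror t.
Proof. by move=> t0; rewrite divr_gt0 ?mulr_gt0// addr_gt0. Qed.

Let le_mirror (e t : R) : 0 < e -> e <= t -> mirror e <= mirror t.
Proof.
move=> e0 et; have t0 := lt_le_trans e0 et.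
have : a - mirror t <= a - mirror e; last by rewrite lerD2l lerN2.
rewrite !mirrorE// ler_wpM2l ?(ltW a0)// ler_wpM2l ?(ltW a0)//.
by rewrite lef_pV2 ?posrE ?addr_gt0// lerD2l.
Qed.

Section primitive.
Variable b : R.
Hypothesis b0 : 0 < b.

Definition half_left_prim (x : R) : R := \int[mu]_(t in `[b, x]) half_left t.

Lemma is_derive_half_left_prim (x : R) : b < x -> is_derive x 1 half_left_prim (half_left x).
Proof.
move=> bx; have x0 := lt_trans b0 bx.
have xx1 : x < x + 1 by rewrite ltrDl.
have int : mu.-integrable `[b, x + 1] (EFin \o half_left).
  apply: continuous_compact_integrable; first exact: segment_compact.
  apply: continuous_within_gt0_itvcc => //; first exact: lt_trans xx1.
  by move=> t; exact: continuous_half_left.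
have [] := @continuous_FTC1 R half_left (BLeft b) x (x + 1) xx1 int _
  (continuous_half_left x0); first by rewrite lte_fin.
by move=> d1 d2; split; [exact: d1|rewrite -derive1E; exact: d2].
Qed.

End primitive.

(** Beyond t = a the point z is negative and the integrand is a pure power,
    which produces the constant in the right side. *)
Lemma integral_half_left (e b : R) : 0 < b -> b < e -> e < a ->
  (\int[mu]_(t in `[e, +oo[) (half_left t)%:E =
   (half_left_prim b a - half_left_prim b e + (s * p * a `^ s)^-1)%:E)%E.
Proof.
move=> b0 be ea; have e0 := lt_trans b0 be.
have mL (D : set (measurableTypeR R)) : measurable D -> D `<=` [set t | 0 < t] ->
    measurable_fun D half_left.
  move=> mD D0; apply: measurable_fun_gt0 => // t; exact: continuous_half_left.
have -> : `[e, +oo[%classic = `[e, a] `|` `]a, +oo[%classic :> set (measurableTypeR R).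
  apply/seteqP; split => t /=; rewrite !in_itv/= !andbT.
    by move=> et; case: (leP t a) => ta; [left; rewrite et|right].
  by move=> [/andP[]//|ta]; exact: ltW (lt_trans ea ta).
rewrite ge0_integral_setU//=; first last.
- apply/disj_setPS => t [] /=; rewrite !in_itv/= andbT => /andP[_ ta] /(le_lt_trans ta).
  by rewrite ltxx.
- by move=> t _; rewrite lee_fin half_left_ge0.
- apply/measurable_EFinP; apply: mL; first exact: measurableU.
  move=> t [] /=; rewrite in_itv/= ?andbT.
    by move=> /andP[+ _]; exact: lt_le_trans.
  exact: lt_trans.
have dL (t : R) : b < t -> is_derive t 1 (half_left_prim b) (half_left t).
  by move=> bt; exact: is_derive_half_left_prim.
have cL (t : R) : b < t -> {for t, continuous (half_left_prim b)}.
  by move=> bt; apply: is_derive_continuous; exact: dL.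
have -> : (\int[mu]_(t in `[e, a]) (half_left t)%:E =
    (half_left_prim b a - half_left_prim b e)%:E)%E.
  rewrite (@continuous_FTC2 _ _ (half_left_prim b))//.
  - by apply: continuous_within_gt0_itvcc => // t; exact: continuous_half_left.
  - split.
    + move=> t; rewrite in_itv/= => /andP[et _].
      by have [] := dL t (lt_trans be et).
    + by apply: cvg_at_right_filter; exact: cL.
    + by apply: cvg_at_left_filter; apply: cL; exact: lt_trans ea.
  - move=> t; rewrite in_itv/= => /andP[et _].
    by rewrite derive1E; have [_] := dL t (lt_trans be et).
rewrite [in RHS]EFinD; congr (_ + _)%E.
transitivity (\int[mu]_(t in `[a, +oo[)
    ((a `^ (s * (p - 1)))%:E * (t `^ (- (1 + s * p)))%:E))%E.
  rewrite -[RHS]integral_itv_obnd_cbnd; last first.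
    apply: measurable_funeM; apply/measurable_EFinP.
    by apply: measurable_funTS; exact: measurable_powR.
  apply: eq_integral => t; rewrite inE/= in_itv/= andbT => at_.
  rewrite -EFinM /half_left pos0 ?subr_le0 ?(ltW at_)// powR0 ?gt_eqF// subr0.
  by rewrite -powRrM.
rewrite ge0_integralZl//; first last.
- by rewrite lee_fin powR_ge0.
- by move=> t _; rewrite lee_fin powR_ge0.
- by apply/measurable_EFinP; apply: measurable_funTS; exact: measurable_powR.
have -> : (s * p * a `^ s)^-1 = a `^ (- s) / (s * p) by rewrite invfM powRN mulrC.
rewrite integral_powR_tail// -EFinM mulrA -powRDp//; congr (_ `^ _ / _)%:E.
by ring.
Qed.

Lemma cvg_mirror : mirror t @[t --> +oo] --> a.
Proof.
have h : a * (1 + a * t `^ (- 1))^-1 @[t --> +oo] --> a * (1 + a * 0)^-1.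
  apply: cvgMr; apply: cvgV; first by rewrite mulr0 addr0 oner_eq0.
  apply: cvgD; first exact: cvg_cst.
  by apply: cvgMr; exact: powR_cvgy0.
rewrite mulr0 addr0 invr1 mulr1 in h.
apply: cvg_trans h; apply: near_eq_cvg; near=> t.
have t0 : 0 < t by near: t; exact: nbhs_pinfty_gt.
rewrite powR_inv1 ?ltW// /mirror; field.
by rewrite !gt_eqF ?addr_gt0.
Unshelve. all: by end_near. Qed.

Lemma cvg_mirror_prim : mirror_prim t @[t --> +oo] --> (1 : R).
Proof.
pose g (v : R) : R := (pos (1 + v) `^ s - pos v `^ s) `^ p.
have g0 : g 0 = 1.
  by rewrite /g addr0 posE// powR1 pos0// powR0 ?gt_eqF// subr0 powR1.
have cg (v : R) : 0 < pos (1 + v) `^ s - pos v `^ s -> {for v, continuous g}.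
  move=> v0; apply: (@continuous_comp _ _ _ (fun v : R => pos (1 + v) `^ s - pos v `^ s)
    (fun z : R => z `^ p)); last exact: continuous_powR_gt0.
  apply: (@continuousB _ _ _ (fun v : R => pos (1 + v) `^ s)
     (fun v : R => pos v `^ s) v); last exact: continuous_pos_powR (ltW s1) _.
  apply: (@continuous_comp _ _ _ (fun v : R => 1 + v) (fun z : R => pos z `^ s)); last first.
    exact: continuous_pos_powR (ltW s1) _.
  by apply: cvgD; [exact: cvg_cst|exact: cvg_id].
have lim0 : a * t `^ (- 1) @[t --> +oo] --> (0 : R).
  by rewrite -[X in _ --> X](mulr0 a); apply: cvgMr; exact: powR_cvgy0.
have : g (a * t `^ (- 1)) @[t --> +oo] --> g 0.
  by apply: (@cvg_comp _ _ _ _ _ _ _ _ lim0); apply: cg;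
    rewrite addr0 posE// powR1 pos0// powR0 ?gt_eqF// subr0.
rewrite g0; apply: cvg_trans; apply: near_eq_cvg; near=> t.
have t0 : 0 < t by near: t; exact: nbhs_pinfty_gt.
have it0 : 0 < t `^ (- 1) by rewrite powR_gt0.
have u0 : 0 <= (a + t) `^ s - a `^ s by rewrite ltW// R_gt0.
rewrite /mirror_prim /g !posE ?addr_ge0 ?mulr_ge0 ?ltW//.
have -> : 1 + a * t `^ (- 1) = (a + t) * t `^ (- 1).
  by rewrite powR_inv1 ?ltW//; field; rewrite gt_eqF.
rewrite !powRM ?addr_ge0 ?ltW// -mulrBl powRM ?powR_ge0// -!powRrM.
by congr (_ * _ `^ _); ring.
Unshelve. all: by end_near. Qed.

(** Composing a primitive of the left integrand with the inversion and adding
    a multiple of [mirror_prim] gives a primitive of the right integrand on all of [e, +oo[;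
    no change of variable in an improper integral is needed. *)
Lemma integral_half_right (e b : R) : 0 < b -> 0 < e -> b < mirror e ->
  (\int[mu]_(t in `[e, +oo[) (half_right t)%:E =
   (half_left_prim b a + (s * p * a `^ s)^-1 -
    (half_left_prim b (mirror e) + (s * p * a `^ s)^-1 * mirror_prim e))%:E)%E.
Proof.
move=> b0 e0 be.
set k := (s * p * a `^ s)^-1.
have k0 : s * p * a `^ s != 0 by rewrite gt_eqF// mulr_gt0// powR_gt0.
pose W (t : R) := half_left_prim b (mirror t) + k * mirror_prim t.
have dW (t : R) : e <= t -> is_derive t 1 W (half_right t).
  move=> et; have t0 := lt_le_trans e0 et.
  apply: is_derive_eq.
    apply: (@is_deriveD _ _ _ (fun t : R => half_left_prim b (mirror t))
      (fun t : R => k * mirror_prim t)).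
      apply: is_derive1_comp (is_derive_mirror t0).
      by apply: is_derive_half_left_prim => //; exact: lt_le_trans (le_mirror e0 et).
    exact: (is_deriveZ k (is_derive_mirror_prim t0)).
  rewrite half_left_mirror// /GRing.scale/= [k * _]mulrA [k * _]mulVf// mul1r; ring.
rewrite (@ge0_continuous_FTC2y _ _ W e (half_left_prim b a + k))//.
- by move=> t _; exact: half_right_ge0.
- by apply: continuous_within_gt0_itvcy => // t; exact: continuous_half_right.
- apply: cvgD.
    apply: (@cvg_comp _ _ _ _ _ _ _ _ cvg_mirror).
    have ba : b < a.
      apply: (lt_le_trans be); rewrite -subr_ge0 mirrorE//.
      by rewrite ltW// mulr_gt0// divr_gt0// addr_gt0.
    exact: is_derive_continuous (is_derive_half_left_prim b0 ba).
  by rewrite -[X in _ --> X](mulr1 k); apply: cvgMr; exact: cvg_mirror_prim.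
- by move=> t et; have [] := dW t (ltW et).
- by apply: cvg_at_right_filter; apply: is_derive_continuous; exact: dW.
- move=> t; rewrite in_itv/= andbT => et.
  by rewrite derive1E; have [_] := dW t (ltW et).
Qed.

(** The constants of the two preceding integrals cancel.  What remains is the
    boundary term [mirror_prim] at e and the left integral between mirror e and
    e, two points at distance at most e^2 / a. *)
Lemma half_line_cancel (e : R) : 0 < e -> e < a ->
  exists l r : R,
  [/\ (\int[mu]_(t in `[e, +oo[) (half_left t)%:E = l%:E)%E,
      (\int[mu]_(t in `[e, +oo[) (half_right t)%:E = r%:E)%E &
      `|l - r| <= ((s * p)^-1 + 4) * (e `^ (1 - s) / a)].
Proof.
move=> e0 ea.
have m0 := mirror_gt0 e0.
(* The base point of the primitive only has to lie below mirror e. *)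
pose b := mirror e / 2.
have b0 : 0 < b by rewrite divr_gt0.
have bm : b < mirror e by rewrite /b ltr_pdivrMr//; hlra.
have mirE : mirror e = e - e ^+ 2 / (a + e).
  by rewrite /mirror; field; rewrite gt_eqF// addr_gt0.
have ae0 : 0 < a + e by rewrite addr_gt0.
have d0 : 0 < e ^+ 2 / (a + e) by rewrite divr_gt0// exprn_gt0.
have me : mirror e < e by hlra.
have me2 : e / 2 <= mirror e.
  have : (a + e)^-1 <= (2 * e)^-1 by rewrite lef_pV2 ?posrE ?mulr_gt0//; hlra.
  move=> /(ler_wpM2l (exprn_ge0 2 (ltW e0))).
  have -> : e ^+ 2 / (2 * e) = e / 2 by field; rewrite gt_eqF.
  by hlra.
do 2 eexists; split.
- by apply: (integral_half_left b0) => //; exact: lt_trans me.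
- exact: (integral_half_right b0).
set k := (s * p * a `^ s)^-1.
have k0 : 0 < k by rewrite invr_gt0 mulr_gt0// powR_gt0.
have -> : half_left_prim b a - half_left_prim b e + k - (half_left_prim b a + k -
    (half_left_prim b (mirror e) + k * mirror_prim e)) =
    k * mirror_prim e - (half_left_prim b e - half_left_prim b (mirror e)) by ring.
rewrite (le_trans (ler_normB _ _))// mulrDl lerD//.
  rewrite ger0_norm ?mulr_ge0 ?powR_ge0 ?(ltW k0)//.
  rewrite /mirror_prim; set u := _ - _.
  have u0 : 0 < u by exact: R_gt0.
  have u1 : u <= a `^ s * (e / a).
    rewrite /u; have -> : a + e = a * (1 + e / a) by field; rewrite gt_eqF.
    rewrite powRM ?addr_ge0 ?divr_ge0 ?(ltW e0) ?(ltW a0)//.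
    rewrite lerBlDr.
    have -> : a `^ s * (e / a) + a `^ s = a `^ s * (1 + e / a) by ring.
    rewrite ler_wpM2l ?powR_ge0//.
    by rewrite ler1_powR ?(ltW s1)// lerDl divr_ge0 ?ltW.
  have /andP[_ u2] : 0 <= u <= e `^ s.
    have := @ub (a + e) a (ltW a0).
    by rewrite [a + e - a]addrAC subrr add0r; apply; rewrite lerDl ltW.
  have -> : u `^ p = u * u `^ (p - 1) by rewrite mulr_powRB1// ?ltW//; hlra.
  have u3 : u `^ (p - 1) <= (e `^ s) `^ (p - 1).
    by rewrite ge0_ler_powR ?nnegrE ?powR_ge0 ?(ltW u0)//; hlra.
  apply: (@le_trans _ _ (k * (a `^ s * (e / a) * (e `^ s) `^ (p - 1) * e `^ (- (s * p))))).
    rewrite ler_wpM2l ?(ltW k0)// ler_wpM2r ?powR_ge0//.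
    by rewrite ler_pM ?powR_ge0 ?(ltW u0).
  have -> : e `^ (1 - s) = e * (e `^ s) `^ (p - 1) * e `^ (- (s * p)).
    transitivity (e `^ 1 * (e `^ s) `^ (p - 1) * e `^ (- (s * p))); last first.
      by rewrite powRr1// ltW.
    by rewrite -powRrM -!powRDp//; congr (_ `^ _); ring.
  rewrite le_eqVlt; apply/orP; left; apply/eqP; rewrite /k.
  have A0 : a `^ s != 0 by rewrite gt_eqF// powR_gt0.
  move: A0; set A := a `^ s; set B := _ `^ (p - 1); set C := e `^ _ => A0.
  by field; rewrite A0 !gt_eqF//; hlra.
have [] := @MVT_segment R (half_left_prim b) half_left (mirror e) e (ltW me).
- move=> t; rewrite in_itv/= => /andP[mt _].
  by apply: is_derive_half_left_prim => //; exact: lt_trans mt.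
- apply: derivable_within_continuous => t; rewrite in_itv/= => /andP[mt _].
  by have [] := @is_derive_half_left_prim b b0 t (lt_le_trans bm mt).
move=> c; rewrite in_itv/= => /andP[mc ce] ->.
have c0 : 0 < c := lt_le_trans m0 mc.
have -> : e - mirror e = e ^+ 2 / (a + e) by rewrite mirE; ring.
rewrite ger0_norm; last by apply: mulr_ge0; [exact: half_left_ge0|exact: ltW].
have h1 : half_left c <= 4 * e `^ (- (1 + s)).
  apply: (le_trans (half_left_le c0)).
  apply: (@le_trans _ _ ((e / 2) `^ (- (1 + s)))).
    rewrite !powRN lef_pV2 ?posrE ?powR_gt0 ?divr_gt0//.
    rewrite ge0_ler_powR ?nnegrE ?divr_ge0 ?(ltW e0) ?(ltW c0)//; first by hlra.
    exact: le_trans mc.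
  rewrite powRM ?(ltW e0)// mulrC ler_wpM2r ?powR_ge0//.
  have -> : (4 : R) = (2^-1) `^ (- 2%:R).
    by rewrite powR_invn// expr2; field.
  rewrite !powRN lef_pV2 ?posrE ?powR_gt0//.
  by apply: ger_powR; hlra.
have h2 : e ^+ 2 / (a + e) <= e ^+ 2 / a.
  by rewrite ler_wpM2l ?exprn_ge0 ?(ltW e0)// lef_pV2 ?posrE// lerDl ltW.
apply: (le_trans (ler_pM (half_left_ge0 _) (ltW d0) h1 h2)).
have -> : e `^ (1 - s) = e `^ (- (1 + s)) * e ^+ 2.
  by rewrite -powR_mulrn ?ltW// -powRDp//; congr (_ `^ _); ring.
by rewrite !mulrA lexx.
Qed.

End half_line.

(** * Chords: increments of (z (c - z))^s against increments of z^s *)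

Section chord.
Variables (R : realType) (s : R).
Hypotheses (s0 : 0 < s) (s1 : s < 1).
Ltac hlra := move: s0 s1 => *; lra.

Definition chord_profile (a b t : R) : R := pos ((a + t) * (b - t)) `^ s.

(** The derivative of (z (c - z))^s with respect to z^s. *)
Definition slope (c w : R) : R := (c - w) `^ s - w * (c - w) `^ (s - 1).

Lemma slopeE (c w : R) : w < c ->
  slope c w = 2 * (c - w) `^ s - c * (c - w) `^ (s - 1).
Proof.
move=> wc; have cw : 0 < c - w by rewrite subr_gt0.
rewrite /slope -(mulr_powRB1 (ltW cw) s0); ring.
Qed.

(** On [0, c - c/4] the distance to the far end c stays above c/4, so negative
    powers of it are comparable to powers of c. *)
Lemma powR_quarter (c r : R) (k : nat) : 0 < c -> - k%:R <= r -> r <= 0 ->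
  (c / 4) `^ r <= 4 ^+ k * c `^ r.
Proof.
move=> c0 kr r0.
rewrite powRM ?(ltW c0)// mulrC ler_wpM2r ?powR_ge0//.
have -> : (4 : R) ^+ k = (4^-1) `^ (- k%:R).
  by rewrite powR_invn// exprVn invrK.
by apply: ger_powR => //; lra.
Qed.

Lemma slope_bound (c w : R) : 0 < c -> 0 <= w <= c - c / 4 ->
  `|slope c w| <= 5 * c `^ s.
Proof.
move=> c0 /andP[w0 wc]; have c4 : 0 < c / 4 by rewrite divr_gt0.
rewrite /slope (le_trans (ler_normB _ _))//.
have -> : 5 * c `^ s = c `^ s + 4 * c `^ s by ring.
apply: lerD.
  rewrite ger0_norm ?powR_ge0// ge0_ler_powR ?nnegrE ?(ltW s0)//; hlra.
rewrite ger0_norm; last by rewrite mulr_ge0 ?powR_ge0.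
have := @powR_quarter c (s - 1) 1 c0.
rewrite expr1 => /(_ ltac:(hlra) ltac:(hlra)) h.
have -> : 4 * c `^ s = c * (4 * c `^ (s - 1)).
  by rewrite -(mulr_powRB1 (ltW c0) s0); ring.
apply: ler_pM; rewrite ?powR_ge0//; first hlra.
apply: le_trans h; have -> : s - 1 = - (1 - s) by ring.
rewrite !powRN lef_pV2 ?posrE ?powR_gt0//; last hlra.
rewrite ge0_ler_powR ?nnegrE; hlra.
Qed.

Lemma slope_lip (c w z : R) : 0 < c -> 0 <= w <= c - c / 4 ->
  0 <= z <= c - c / 4 -> `|slope c w - slope c z| <= 24 * c `^ (s - 1) * `|w - z|.
Proof.
move=> c0 /andP[w0 wc] /andP[z0 zc]; have c4 : 0 < c / 4 by rewrite divr_gt0.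
rewrite !slopeE; try hlra.
have lipr r := @powR_lip_ge R r (c / 4) (c - w) (c - z).
have d : `|c - w - (c - z)| = `|w - z| by rewrite distrC; congr `|_|; ring.
have lip1 : `|(c - w) `^ s - (c - z) `^ s| <= 4 * c `^ (s - 1) * `|w - z|.
  have := lipr s; rewrite d => h; apply: (le_trans (h _ _ _ _)) => //; try hlra.
  rewrite ler_wpM2r// gtr0_norm//.
  have := @powR_quarter c (s - 1) 1 c0.
  rewrite expr1 => /(_ ltac:(hlra) ltac:(hlra)); apply: le_trans.
  by rewrite ler_piMl ?powR_ge0// ltW.
have lip2 : `|(c - w) `^ (s - 1) - (c - z) `^ (s - 1)| <=
    16 * c `^ (s - 2) * `|w - z|.
  have := lipr (s - 1); rewrite d => h; apply: (le_trans (h _ _ _ _)) => //; try hlra.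
  have -> : s - 1 - 1 = s - 2 by ring.
  rewrite ler_wpM2r// ltr0_norm; last hlra.
  have := @powR_quarter c (s - 2) 2 c0.
  have -> : (4 : R) ^+ 2 = 16 by ring.
  move=> /(_ ltac:(hlra) ltac:(hlra)); apply: le_trans; rewrite ler_piMl ?powR_ge0//; hlra.
have -> : 2 * (c - w) `^ s - c * (c - w) `^ (s - 1) -
   (2 * (c - z) `^ s - c * (c - z) `^ (s - 1)) =
   2 * ((c - w) `^ s - (c - z) `^ s) -
   c * ((c - w) `^ (s - 1) - (c - z) `^ (s - 1)) by ring.
rewrite (le_trans (ler_normB _ _))// !normrM (gtr0_norm c0) ger0_norm//.
(* 24 = 2 * 4 + 16, from the two bounds above. *)
have -> : 24 * c `^ (s - 1) * `|w - z| = 2 * (4 * c `^ (s - 1) * `|w - z|) +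
   c * (16 * c `^ (s - 2) * `|w - z|).
  have -> : c `^ (s - 1) = c * c `^ (s - 2).
    rewrite -[X in X * _](powRr1 (ltW c0)) -powRDp//; congr (_ `^ _); ring.
  ring.
by apply: lerD; rewrite ler_wpM2l// ltW.
Qed.

Let cauchy (c x y : R) : 0 < c -> 0 <= x -> x < y -> y <= c - c / 4 ->
  exists2 w, x < w < y &
    pos y `^ s * pos (c - y) `^ s - pos x `^ s * pos (c - x) `^ s =
    slope c w * (pos y `^ s - pos x `^ s).
Proof.
move=> c0 x0 xy yc.
have c4 : 0 < c / 4 by rewrite divr_gt0.
pose g (z : R) := pos z `^ s.
pose k (z : R) := pos (c - z) `^ s.
have cg : continuous g by exact: continuous_pos_powR (ltW s1).
have ck : continuous k.
  move=> z; apply: (@continuous_comp _ _ _ (fun z : R => c - z)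
    (fun z : R => pos z `^ s)); last first.
    exact: continuous_pos_powR (ltW s1) _.
  by apply: cvgB; [exact: cvg_cst|exact: cvg_id].
have dg (z : R) : z \in `]x, y[ -> is_derive z 1 g (s * z `^ (s - 1)).
  rewrite in_itv/= => /andP[xz _]; have z0 := le_lt_trans x0 xz.
  apply: near_eq_is_derive (is_derive1_powR s z0).
  by near=> w; rewrite /g posE// ltW//; near: w; exact: lt_nbhsr.
have dk (z : R) : z \in `]x, y[ -> is_derive z 1 k (- (s * (c - z) `^ (s - 1))).
  rewrite in_itv/= => /andP[xz zy].
  have cz : 0 < c - z by hlra.
  have zc : z < c by hlra.
  apply: (@near_eq_is_derive _ _ _ (fun w : R => (c - w) `^ s)).
    near=> w; rewrite /k posE// subr_ge0 ltW//; near: w; exact: lt_nbhsl.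
  rewrite -[X in is_derive _ _ _ X]mulrN1.
  apply: (@is_derive1_comp _ (fun z => z `^ s) (fun w => c - w)).
    exact: is_derive1_powR.
  rewrite -[X in is_derive _ _ _ X]sub0r.
  by apply: (@is_deriveB _ _ _ (cst c) id).
have dgn0 (z : R) : z \in `]x, y[ -> s * z `^ (s - 1) != 0.
  rewrite in_itv/= => /andP[xz _]; have z0 := le_lt_trans x0 xz.
  by rewrite gt_eqF// mulr_gt0// powR_gt0.
have [||z zxy|w wxy E] := @cauchy_MVT R (g * k) (fun z => s * z `^ (s - 1) * k z -
    g z * (s * (c - z) `^ (s - 1))) g (fun z => s * z `^ (s - 1)) x y xy _ _ _ dg dgn0.
- by apply: continuous_subspaceT => z; apply: cvgM; [exact: cg|exact: ck].
- exact: continuous_subspaceT.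
- apply: is_derive_eq; first exact: (is_deriveM (dg z zxy) (dk z zxy)).
  by rewrite /GRing.scale/=; ring.
have := wxy; rewrite in_itv/= => wxy'; exists w => //.
have /andP[xw wy] := wxy'.
have w0 := le_lt_trans x0 xw.
have gxy : 0 < g y - g x.
  rewrite subr_gt0 /g !posE ?(le_trans x0 (ltW xy))//.
  by rewrite gt0_ltr_powR ?nnegrE ?(le_trans x0 (ltW xy)).
rewrite -[LHS](@divfK _ (g y - g x)) -?E.
- congr (_ * _); rewrite /slope /g /k !posE ?(ltW w0)//; last hlra.
  have P0 : w `^ (s - 1) != 0 by rewrite gt_eqF// powR_gt0.
  rewrite -(mulr_powRB1 (ltW w0) s0).
  set A := w `^ _ in P0 *; set B := (c - w) `^ s; set C := (c - w) `^ _.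
  by field; rewrite P0 gt_eqF.
- by rewrite gt_eqF.
Unshelve. all: by end_near. Qed.

(** Cauchy's mean value theorem, applied to the profile and to z^s; the
    positive parts in the auxiliary statement make both continuous up to
    z = 0, where z^s is not differentiable. *)
Lemma chord_slope (c a z : R) : 0 < c -> 0 <= a <= c - c / 4 ->
  0 <= z <= c - c / 4 ->
  exists2 w, 0 <= w <= c - c / 4 /\ `|w - a| <= `|z - a| &
    a `^ s * (c - a) `^ s - z `^ s * (c - z) `^ s = slope c w * (a `^ s - z `^ s).
Proof.
move=> c0 /andP[a0 ac] /andP[z0 zc].
have c4 : 0 < c / 4 by rewrite divr_gt0.
have ps (x : R) : 0 <= x -> x <= c - c / 4 -> pos x = x /\ pos (c - x) = c - x.
  by move=> x0 xc; rewrite !posE//; hlra.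
have [pa pca] := ps a a0 ac; have [pz pcz] := ps z z0 zc.
have [az|za|->] := ltgtP a z.
- have [w /andP[aw wz]] := cauchy c0 a0 az zc.
  rewrite pa pca pz pcz => E; exists w.
    split; first hlra.
    by rewrite !gtr0_norm ?subr_gt0//; hlra.
  by rewrite -opprB E; ring.
- have [w /andP[aw wz]] := cauchy c0 z0 za ac.
  rewrite pa pca pz pcz => E; exists w => //.
  split; first hlra.
  by rewrite !ltr0_norm ?subr_lt0//; hlra.
- by exists z; [rewrite z0 zc|rewrite !subrr mulr0].
Qed.

End chord.

(** * A chord differs from the half-line by an integrable error *)

(** Sum of the constants of the near and far estimates, doubled since each t > 0
    stands for t and -t. *)
Definition err_const (R : realType) (p : R) : R :=
  2 * ((p - 1) * 5 `^ (p - 2) * 24 + 2 * 5 `^ (p - 1)).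

Lemma err_const_ge0 (R : realType) (p : R) : 2 < p -> 0 <= err_const p.
Proof.
by move=> p2; rewrite /err_const mulr_ge0// addr_ge0 ?mulr_ge0 ?powR_ge0//; lra.
Qed.

Section comparison.
Variables (R : realType) (s p : R).
Hypotheses (s0 : 0 < s) (s1 : s < 1) (p2 : 2 < p).
Ltac hlra := move: s0 s1 p2 => *; lra.
Variables (a b : R).
Hypotheses (a0 : 0 < a) (ab : a <= b).
Local Notation c := (a + b).
Local Notation profile := (chord_profile s a b).

(** The multiple of the half-line that agrees with the chord to first order at
    the point a.  It is not b^(s(p-1)), the value suggested by freezing the
    factor (c - z)^s: the derivative of that factor also counts. *)
Definition comparison_ratio : R := spow p (slope s (a + b) a).

Local Notation kappa := comparison_ratio.

Let b0 : 0 < b. Proof. exact: lt_le_trans ab. Qed.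
Let c0 : 0 < c. Proof. exact: addr_gt0. Qed.
Let a_range : 0 <= a <= c - c / 4.
Proof. by move: a0 ab => *; apply/andP; split; lra. Qed.
Let p1 : 1 < p. Proof. hlra. Qed.

Lemma norm_comparison_ratio : `|kappa| <= 5 `^ (p - 1) * c `^ (s * (p - 1)).
Proof.
rewrite /kappa norm_spow// powRrM -powRM ?powR_ge0//.
rewrite ge0_ler_powR ?nnegrE ?mulr_ge0 ?powR_ge0//; first hlra.
exact: slope_bound.
Qed.

Definition chord_err (t : R) : R :=
  spow p (profile 0 - profile t) - kappa * spow p (a `^ s - pos (a + t) `^ s).

(** Multiplicativity of the odd power reduces the error to the variation of
    [slope], which brings an extra factor |t| / c. *)
Lemma chord_err_near (t : R) : `|t| <= c / 4 ->
  `|chord_err t| <=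
    (p - 1) * (5 * c `^ s) `^ (p - 2) * (24 * c `^ (s - 1)) *
      (`|t| * `|t| `^ (s * (p - 1))).
Proof.
move=> tc.
have [t1 t2] : - (c / 4) <= t /\ t <= c / 4 by move: tc; rewrite ler_norml => /andP.
have z_range : 0 <= pos (a + t) <= c - c / 4.
  rewrite pos_ge0/=; have [h|/ltW h] := leP 0 (a + t).
    by rewrite posE//; move: a0 ab => *; lra.
  by rewrite pos0//; move: a0 ab => *; lra.
have za : `|pos (a + t) - a| <= `|t|.
  rewrite -[in X in _ - X](posE (ltW a0)); apply: (le_trans (pos_lip _ _)).
  by rewrite addrC addKr.
have ca : c - a = b by ring.
have V0 : profile 0 = a `^ s * (c - a) `^ s.
  by rewrite /chord_profile addr0 subr0 ca posE ?mulr_ge0 ?powRM// ltW.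
have Vt : profile t = pos (a + t) `^ s * (c - pos (a + t)) `^ s.
  rewrite /chord_profile; have bt : 0 <= b - t by move: a0 ab => *; lra.
  have [h|/ltW h] := leP 0 (a + t).
    rewrite [pos (a + t)]posE// posE ?mulr_ge0// powRM//; congr (_ * _ `^ _); ring.
  rewrite pos0; last by rewrite mulr_le0_ge0.
  by rewrite pos0// powR0 ?mul0r// gt_eqF.
have [w [w_range wa]] := chord_slope s0 s1 c0 a_range z_range.
rewrite -V0 -Vt /chord_err => ->.
rewrite spowM -mulrBl normrM.
have h1 := spow_lip (ltW p2) (slope_bound s0 s1 c0 w_range)
  (slope_bound s0 s1 c0 a_range).
have h2 := slope_lip s0 s1 c0 w_range a_range.
rewrite norm_spow//.
have h3 : `|a `^ s - pos (a + t) `^ s| `^ (p - 1) <= `|t| `^ (s * (p - 1)).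
  rewrite powRrM ge0_ler_powR ?nnegrE ?powR_ge0//; first hlra.
  apply: (le_trans (powR_holder (ltW s0) (ltW s1) (ltW a0) (pos_ge0 _))).
  by rewrite ge0_ler_powR ?nnegrE ?(ltW s0)// distrC.
have -> : (p - 1) * (5 * c `^ s) `^ (p - 2) * (24 * c `^ (s - 1)) *
      (`|t| * `|t| `^ (s * (p - 1))) =
   ((p - 1) * (5 * c `^ s) `^ (p - 2) * (24 * c `^ (s - 1) * `|t|)) *
      `|t| `^ (s * (p - 1)) by ring.
apply: ler_pM => //.
apply: (le_trans h1); rewrite ler_wpM2l//; first by rewrite mulr_ge0 ?powR_ge0//; hlra.
apply: (le_trans h2); rewrite ler_wpM2l ?mulr_ge0 ?powR_ge0//.
exact: le_trans za.
Qed.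

Let profile_range t : 0 <= profile t <= (c ^+ 2) `^ s.
Proof.
rewrite powR_ge0/= ge0_ler_powR ?nnegrE ?(ltW s0) ?pos_ge0 ?exprn_ge0 ?(ltW c0)//.
rewrite /pos ge_max exprn_ge0 ?(ltW c0)//=.
have -> : (a + t) * (b - t) = c ^+ 2 - ((a + t) ^+ 2 + (b - t) ^+ 2 + (a + t) * (b - t)).
  ring.
have := sqr_ge0 ((a + t) + (b - t)); have := sqr_ge0 (a + t); have := sqr_ge0 (b - t).
by rewrite !expr2; nra.
Qed.

Lemma norm_spow_profile t :
  `|spow p (profile 0 - profile t)| <= c `^ (s * (p - 1)) * c `^ (s * (p - 1)).
Proof.
rewrite norm_spow// -powRM ?(ltW c0)// -expr2 powRrM.
rewrite ge0_ler_powR ?nnegrE ?powR_ge0//; first hlra.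
have /andP[x0 x1] := profile_range 0; have /andP[y0 y1] := profile_range t.
by rewrite ler_norml; apply/andP; split; lra.
Qed.

(** At distance comparable to c or larger no comparison is needed: each of the
    two terms is small enough by itself. *)
Lemma chord_err_far (t : R) : c / 4 <= `|t| ->
  `|chord_err t| <= 2 * 5 `^ (p - 1) * c `^ (s * (p - 1)) * `|t| `^ (s * (p - 1)).
Proof.
move=> tc.
have t0 : 0 <= `|t| by [].
have sp10 : 0 <= s * (p - 1) by rewrite mulr_ge0 ?(ltW s0)//; hlra.
have -> : 2 * 5 `^ (p - 1) * c `^ (s * (p - 1)) * `|t| `^ (s * (p - 1)) =
  c `^ (s * (p - 1)) * (5 `^ (p - 1) * `|t| `^ (s * (p - 1))) +
  5 `^ (p - 1) * c `^ (s * (p - 1)) * `|t| `^ (s * (p - 1)) by ring.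
rewrite /chord_err (le_trans (ler_normB _ _))// lerD//.
  apply: (le_trans (norm_spow_profile t)); rewrite ler_wpM2l ?powR_ge0//.
  apply: (@le_trans _ _ ((4 * `|t|) `^ (s * (p - 1)))).
    rewrite ge0_ler_powR ?nnegrE ?(ltW c0)//; lra.
  rewrite powRM// ler_wpM2r ?powR_ge0//.
  apply: (@le_trans _ _ (5 `^ (s * (p - 1)))).
    by rewrite ge0_ler_powR ?nnegrE//; lra.
  apply: ler_powR; first by lra.
  by rewrite ler_piMl ?(ltW s1)//; hlra.
rewrite normrM ler_pM//; first exact: norm_comparison_ratio.
rewrite norm_spow// powRrM ge0_ler_powR ?nnegrE ?powR_ge0//; first hlra.
apply: (le_trans (powR_holder (ltW s0) (ltW s1) (ltW a0) (pos_ge0 _))).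
rewrite ge0_ler_powR ?nnegrE ?(ltW s0)//.
rewrite -[in X in `|X - _|](posE (ltW a0)); apply: (le_trans (pos_lip _ _)).
by rewrite opprD addrA subrr sub0r normrN.
Qed.

(** The integrand along a line at parameters t and -t, up to powers of the
    speed. *)
Definition chord_sym (t : R) : R :=
  (spow p (profile 0 - profile t) + spow p (profile 0 - profile (- t))) *
  t `^ (- (1 + s * p)).

Definition half_sym (t : R) : R := half_left s p a t - half_right s p a t.

Definition err_sym (t : R) : R := chord_sym t - kappa * half_sym t.

Let err_constE : err_const p / 2 = (p - 1) * 5 `^ (p - 2) * 24 + 2 * 5 `^ (p - 1).
Proof. by rewrite /err_const; field. Qed.

Lemma err_symE t : 0 < t ->
  err_sym t = (chord_err t + chord_err (- t)) * t `^ (- (1 + s * p)).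
Proof.
move=> t0; rewrite /err_sym /chord_sym /half_sym /half_left /half_right /chord_err.
have at0 : 0 <= a + t by rewrite addr_ge0 ?ltW.
rewrite (posE at0).
have -> : spow p (a `^ s - (a + t) `^ s) = - ((a + t) `^ s - a `^ s) `^ (p - 1).
  rewrite -spow_ge0E//; first by rewrite -spowN opprB.
  by rewrite subr_ge0 ge0_ler_powR ?nnegrE ?(ltW s0) ?(ltW a0)// lerDl ltW.
have -> : spow p (a `^ s - pos (a - t) `^ s) = (a `^ s - pos (a - t) `^ s) `^ (p - 1).
  rewrite spow_ge0E// subr_ge0 ge0_ler_powR ?nnegrE ?(ltW s0) ?pos_ge0 ?(ltW a0)//.
  have [h|/ltW h] := leP 0 (a - t); first by rewrite posE//; lra.
  by rewrite pos0// ltW.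
set X := spow p (profile 0 - profile t).
set Y := spow p (profile 0 - profile (- t)).
set Z := (a `^ s - pos (a - t) `^ s) `^ (p - 1).
set W := ((a + t) `^ s - a `^ s) `^ (p - 1).
set T := t `^ (- (1 + s * p)).
move: X Y Z W T kappa => X Y Z W T k; ring.
Qed.

Lemma err_sym_near t : 0 < t -> t <= c / 4 ->
  `|err_sym t| <= err_const p * c `^ (s * (p - 1) - 1) * t `^ (- s).
Proof.
move=> t0 tc; rewrite err_symE// normrM (ger0_norm (powR_ge0 _ _)).
have h : forall r, `|r| = t -> `|chord_err r| <= (err_const p / 2) * c `^ (s * (p - 1) - 1) *
    (t * t `^ (s * (p - 1))).
  move=> r rt; have := @chord_err_near r; rewrite rt => /(_ tc) /le_trans; apply.
  rewrite ler_wpM2r ?mulr_ge0 ?powR_ge0 ?(ltW t0)//.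
  rewrite powRM ?powR_ge0// -powRrM.
  have -> : c `^ (s * (p - 1) - 1) = c `^ (s * (p - 2)) * c `^ (s - 1).
    by rewrite -powRDp//; congr (_ `^ _); ring.
  set A := c `^ _; set B := c `^ _.
  have -> : (p - 1) * (5 `^ (p - 2) * A) * (24 * B) =
      ((p - 1) * 5 `^ (p - 2) * 24) * (A * B) by ring.
  rewrite ler_wpM2r ?mulr_ge0 ?powR_ge0// err_constE.
  by rewrite lerDl mulr_ge0 ?powR_ge0.
have -> : err_const p * c `^ (s * (p - 1) - 1) * t `^ (- s) =
  (err_const p / 2 * c `^ (s * (p - 1) - 1) * (t * t `^ (s * (p - 1))) +
  err_const p / 2 * c `^ (s * (p - 1) - 1) * (t * t `^ (s * (p - 1)))) * t `^ (- (1 + s * p)).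
  have -> : t `^ (- s) = t * t `^ (s * (p - 1)) * t `^ (- (1 + s * p)).
    rewrite -[X in X * _ * _](powRr1 (ltW t0)) -!powRDp//; congr (_ `^ _); ring.
  by field.
rewrite ler_wpM2r ?powR_ge0// (le_trans (ler_normD _ _))//.
by apply: lerD; apply: h; rewrite ?normrN gtr0_norm.
Qed.

Lemma err_sym_far t : 0 < t -> c / 4 <= t ->
  `|err_sym t| <= err_const p * c `^ (s * (p - 1)) * t `^ (- (1 + s)).
Proof.
move=> t0 tc; rewrite err_symE// normrM (ger0_norm (powR_ge0 _ _)).
have h : forall r, `|r| = t -> `|chord_err r| <= (err_const p / 2) * c `^ (s * (p - 1)) *
    t `^ (s * (p - 1)).
  move=> r rt; have := @chord_err_far r; rewrite rt => /(_ tc) /le_trans; apply.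
  rewrite ler_wpM2r ?powR_ge0// ler_wpM2r ?powR_ge0// err_constE.
  by rewrite lerDr !mulr_ge0 ?powR_ge0//; hlra.
have -> : err_const p * c `^ (s * (p - 1)) * t `^ (- (1 + s)) =
  (err_const p / 2 * c `^ (s * (p - 1)) * t `^ (s * (p - 1)) +
  err_const p / 2 * c `^ (s * (p - 1)) * t `^ (s * (p - 1))) * t `^ (- (1 + s * p)).
  have -> : t `^ (- (1 + s)) = t `^ (s * (p - 1)) * t `^ (- (1 + s * p)).
    by rewrite -powRDp//; congr (_ `^ _); ring.
  by field.
rewrite ler_wpM2r ?powR_ge0// (le_trans (ler_normD _ _))//.
by apply: lerD; apply: h; rewrite ?normrN gtr0_norm.
Qed.

End comparison.

(** * Truncated integrals along one line *)

Section line_integrals.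
Variables (R : realType) (s p : R).
Hypotheses (s0 : 0 < s) (s1 : s < 1) (p2 : 2 < p).
Ltac hlra := move: s0 s1 p2 => *; lra.
Local Notation mu := (@lebesgue_measure R).

Lemma integrable_tail (f : R -> R) (e r K : R) : 0 < r -> 0 < e ->
  measurable_fun (`[e, +oo[%classic : set R) f ->
  (forall t, e <= t -> `|f t| <= K * t `^ (- (1 + r))) ->
  mu.-integrable `[e, +oo[ (EFin \o f).
Proof.
move=> r0 e0 mf fK.
have int : mu.-integrable `[e, +oo[ (fun t => K%:E * (t `^ (- (1 + r)))%:E)%E.
  apply: integrableZl => //; apply/integrableP; split.
    by apply/measurable_EFinP; apply: measurable_funTS; exact: measurable_powR.
  under eq_integral do rewrite gee0_abs ?lee_fin ?powR_ge0//.
  by rewrite integral_powR_tail// ltey.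
apply: le_integrable int => //; first exact/measurable_EFinP.
move=> t; rewrite /= in_itv/= andbT => et.
by rewrite lee_fin (le_trans (fK _ et))// ler_norm.
Qed.

Section near_end.
Variables (a b : R).
Hypotheses (a0 : 0 < a) (ab : a <= b).
Local Notation c := (a + b).
Let c0 : 0 < c. Proof. by rewrite addr_gt0// (lt_le_trans a0). Qed.

Let sub_gt0 (e : R) : 0 < e -> (`[e, +oo[%classic : set R) `<=` [set t | 0 < t].
Proof. by move=> e0 t /=; rewrite in_itv/= andbT; exact: lt_le_trans. Qed.

Lemma integrable_half_left (e : R) : 0 < e ->
  mu.-integrable `[e, +oo[ (EFin \o half_left s p a).
Proof.
move=> e0; apply: (@integrable_tail _ e s 1) => //.
- apply: measurable_fun_gt0 => //; last exact: sub_gt0.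
  by move=> t; exact: continuous_half_left.
- move=> t et; rewrite mul1r ger0_norm ?half_left_ge0//.
  by apply: half_left_le => //; exact: lt_le_trans et.
Qed.

Lemma integrable_half_right (e : R) : 0 < e ->
  mu.-integrable `[e, +oo[ (EFin \o half_right s p a).
Proof.
move=> e0; apply: (@integrable_tail _ e s 1) => //.
- apply: measurable_fun_gt0 => //; last exact: sub_gt0.
  by move=> t; exact: continuous_half_right.
- move=> t et; rewrite mul1r ger0_norm ?half_right_ge0//.
  by apply: half_right_le => //; exact: lt_le_trans et.
Qed.

Lemma integrable_half_sym (e : R) : 0 < e ->
  mu.-integrable `[e, +oo[ (EFin \o half_sym s p a).
Proof.
move=> e0.
have -> : EFin \o half_sym s p a =
    ((EFin \o half_left s p a) \- (EFin \o half_right s p a))%E by exact/funext.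
by apply: integrableB => //; [exact: integrable_half_left|exact: integrable_half_right].
Qed.

Lemma measurable_chord_profile : measurable_fun setT (chord_profile s a b).
Proof.
apply: (measurableT_comp (@measurable_pos_powR R s)).
apply: measurable_funM; first exact: measurable_funD.
by apply: measurable_funB.
Qed.

Lemma measurable_chord_sym : measurable_fun setT (chord_sym s p a b).
Proof.
apply: measurable_funM => //; apply: measurable_funD.
  apply: (measurableT_comp (@measurable_spow R p)).
  by apply: measurable_funB => //; exact: measurable_chord_profile.
apply: (measurableT_comp (@measurable_spow R p)).
apply: measurable_funB => //.
by apply: (measurableT_comp measurable_chord_profile); exact: measurable_funN.
Qed.

Lemma integrable_chord_sym (e : R) : 0 < e ->
  mu.-integrable `[e, +oo[ (EFin \o chord_sym s p a b).
Proof.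
move=> e0; apply: (@integrable_tail _ e (s * p)
  (2 * (c `^ (s * (p - 1)) * c `^ (s * (p - 1))))) => //.
- by rewrite mulr_gt0//; hlra.
- by apply: measurable_funTS; exact: measurable_chord_sym.
- move=> t et; rewrite normrM (ger0_norm (powR_ge0 _ _)) ler_wpM2r ?powR_ge0//.
  rewrite (le_trans (ler_normD _ _))// mulrDl !mul1r.
  by apply: lerD; exact: norm_spow_profile.
Qed.

Definition half_const : R := (s * p)^-1 + 4.

Lemma half_sym_integral (e : R) : 0 < e -> e < a ->
  `|\int[mu]_(t in `[e, +oo[) half_sym s p a t| <= half_const * (e `^ (1 - s) / a).
Proof.
move=> e0 ea; have [l [r [El Er lr]]] := half_line_cancel s0 s1 p2 a0 e0 ea.
have RL : \int[mu]_(t in `[e, +oo[) half_left s p a t = l.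
  by rewrite /Rintegral El.
have RR : \int[mu]_(t in `[e, +oo[) half_right s p a t = r.
  by rewrite /Rintegral Er.
have -> : \int[mu]_(t in `[e, +oo[) half_sym s p a t = l - r; last exact: lr.
rewrite -[in RHS]RL -[in RHS]RR; apply: RintegralB => //.
  exact: integrable_half_left.
exact: integrable_half_right.
Qed.

Let split_at (e' e : R) : e' < e ->
  `[e', +oo[%classic = `[e', e[ `|` `[e, +oo[ :> set R.
Proof.
move=> ee; apply/seteqP; split => t /=; rewrite !in_itv/= !andbT.
  by move=> et; case: (ltP t e) => te; [left; rewrite et|right].
by move=> [/andP[]//|te]; exact: le_trans (ltW ee) te.
Qed.

Lemma half_sym_integral_annulus (e' e : R) : 0 < e' -> e' < e -> e < a ->
  `|\int[mu]_(t in `[e', e[) half_sym s p a t| <=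
  2 * half_const * (e `^ (1 - s) / a).
Proof.
move=> e'0 ee ea; have e0 := lt_trans e'0 ee.
have := half_sym_integral e'0 (lt_trans ee ea).
have := half_sym_integral e0 ea.
rewrite (split_at ee) Rintegral_setU//; last 2 first.
- by rewrite -split_at//; exact: integrable_half_sym.
- apply/disj_setPS => t [] /=; rewrite !in_itv/= andbT => /andP[_ te] /(lt_le_trans te).
  by rewrite ltxx.
set y := Rintegral _ _ _; set x := Rintegral _ _ _ => hy hxy.
have h : e' `^ (1 - s) / a <= e `^ (1 - s) / a.
  rewrite ler_wpM2r ?invr_ge0 ?(ltW a0)//.
  by rewrite ge0_ler_powR ?nnegrE ?subr_ge0 ?(ltW s1) ?(ltW e'0) ?(ltW e0) ?(ltW ee).
have K0 : 0 <= half_const.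
  by rewrite /half_const addr_ge0// invr_ge0 mulr_ge0 ?(ltW s0)//; hlra.
have -> : x = (x + y) - y by ring.
rewrite (le_trans (ler_normB _ _))//.
have := ler_wpM2l K0 h; lra.
Qed.

Lemma integrable_err_sym (e : R) : 0 < e ->
  mu.-integrable `[e, +oo[ (EFin \o err_sym s p a b).
Proof.
move=> e0.
have -> : EFin \o err_sym s p a b = ((EFin \o chord_sym s p a b) \-
   (fun t => (comparison_ratio s p a b)%:E * (EFin \o half_sym s p a) t))%E.
  by exact/funext.
apply: integrableB => //; first exact: integrable_chord_sym.
by apply: integrableZl => //; exact: integrable_half_sym.
Qed.

Lemma chord_le_half_err (e : R) (J : set (measurableTypeR R)) (H B : R) :
  0 < e -> measurable J -> J `<=` `[e, +oo[%classic ->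
  `|\int[mu]_(t in J) half_sym s p a t| <= H ->
  (\int[mu]_(t in J) `|err_sym s p a b t|%:E <= B%:E)%E ->
  `|\int[mu]_(t in J) chord_sym s p a b t| <=
    5 `^ (p - 1) * c `^ (s * (p - 1)) * H + B.
Proof.
move=> e0 mJ Je hH hB.
have int f : mu.-integrable `[e, +oo[ f -> mu.-integrable J f.
  by apply: integrableS.
have ierr := int _ (integrable_err_sym e0).
have ihalf := int _ (integrable_half_sym e0).
have -> : \int[mu]_(t in J) chord_sym s p a b t =
    comparison_ratio s p a b * \int[mu]_(t in J) half_sym s p a t +
    \int[mu]_(t in J) err_sym s p a b t.
  rewrite -RintegralZl// -RintegralD//; last first.
    exact: (integrableZl mJ (comparison_ratio s p a b) ihalf).
  by apply: eq_Rintegral => t _; rewrite /err_sym addrC subrK.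
rewrite (le_trans (ler_normD _ _))// lerD//.
  rewrite normrM ler_pM//; exact: norm_comparison_ratio.
apply: (le_trans (le_normr_Rintegral mJ ierr)).
rewrite -lee_fin; apply: le_trans hB; rewrite /Rintegral fineK//.
have := integrable_fin_num mJ (integrable_norm ierr); exact.
Qed.

Lemma err_sym_integral_annulus (e' e : R) : 0 < e' -> e' < e -> e <= c / 4 ->
  (\int[mu]_(t in `[e', e]) `|err_sym s p a b t|%:E <=
   (err_const p * c `^ (s * (p - 1) - 1) * (e `^ (1 - s) / (1 - s)))%:E)%E.
Proof.
move=> e'0 ee ec.
have K0 : 0 <= err_const p * c `^ (s * (p - 1) - 1).
  by rewrite mulr_ge0 ?powR_ge0// (err_const_ge0 p2).
apply: (@le_trans _ _ (\int[mu]_(t in `[e', e])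
    ((err_const p * c `^ (s * (p - 1) - 1))%:E * (t `^ (- s))%:E))%E).
  apply: ge0_le_integral => //.
  - apply/measurable_EFinP; apply: measurableT_comp => //.
    have /integrableP[/measurable_EFinP m _] := integrable_err_sym e'0.
    apply: measurable_funS m => // t /=; rewrite !in_itv/= andbT.
    by case/andP.
  - apply: measurable_funeM; apply/measurable_EFinP.
    by apply: measurable_funTS; exact: measurable_powR.
  - move=> t; rewrite /= in_itv/= => /andP[et te].
    rewrite -EFinM lee_fin; apply: err_sym_near => //.
      exact: lt_le_trans et.
    exact: le_trans ec.
rewrite ge0_integralZl//; first last.
- by move=> t _; rewrite lee_fin powR_ge0.
- by apply/measurable_EFinP; apply: measurable_funTS; exact: measurable_powR.
by rewrite [X in (_ <= X)%E]EFinM lee_wpmul2l ?lee_fin// integral_powR_near0.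
Qed.

Lemma err_sym_integral (e : R) : 0 < e -> e < c / 4 ->
  (\int[mu]_(t in `[e, +oo[) `|err_sym s p a b t|%:E <=
   (err_const p * ((1 - s)^-1 + 4 / s) * c `^ (s * (p - 2)))%:E)%E.
Proof.
move=> e0 ec.
have c40 : 0 < c / 4 by rewrite divr_gt0.
have s1' : 0 < 1 - s by rewrite subr_gt0.
have K0 : 0 <= err_const p * c `^ (s * (p - 1)).
  by rewrite mulr_ge0 ?powR_ge0// (err_const_ge0 p2).
have /integrableP[/measurable_EFinP m _] := integrable_err_sym e0.
have mn : measurable_fun (`[e, +oo[%classic : set R) (fun t => `|err_sym s p a b t|%:E).
  by apply/measurable_EFinP; apply: measurableT_comp.
have mn' := mn; move: mn'; rewrite (split_at ec) => mn'.
rewrite ge0_integral_setU//; last first.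
  apply/disj_setPS => t [] /=; rewrite !in_itv/= andbT => /andP[_ te] /(lt_le_trans te).
  by rewrite ltxx.
have near : (\int[mu]_(t in `[e, (c / 4)%R[) `|err_sym s p a b t|%:E <=
    (err_const p * c `^ (s * (p - 2)) * (1 - s)^-1)%:E)%E.
  apply: (@le_trans _ _ (\int[mu]_(t in `[e, (c / 4)%R]) `|err_sym s p a b t|%:E)%E).
    apply: ge0_subset_integral => //.
    - by apply: measurable_funS mn => // t /=; rewrite !in_itv/= andbT => /andP[].
    - by move=> t /=; rewrite !in_itv/= => /andP[-> /ltW ->].
  apply: (le_trans (err_sym_integral_annulus e0 ec (lexx _))).
  rewrite lee_fin; move: (err_const p) (err_const_ge0 p2) => K KK.
  rewrite -!mulrA ler_wpM2l// mulrA.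
  rewrite ler_wpM2r ?invr_ge0 ?(ltW s1')//.
  have -> : c `^ (s * (p - 2)) = c `^ (s * (p - 1) - 1) * c `^ (1 - s).
    by rewrite -powRDp//; congr (_ `^ _); ring.
  rewrite ler_wpM2l ?powR_ge0// ge0_ler_powR ?nnegrE ?(ltW s1') ?(ltW c40) ?(ltW c0)//.
  by move: c0 => *; lra.
have far : (\int[mu]_(t in `[(c / 4)%R, +oo[) `|err_sym s p a b t|%:E <=
    (err_const p * c `^ (s * (p - 2)) * (4 / s))%:E)%E.
  apply: (@le_trans _ _ (\int[mu]_(t in `[(c / 4)%R, +oo[)
    ((err_const p * c `^ (s * (p - 1)))%:E * (t `^ (- (1 + s)))%:E))%E).
    apply: ge0_le_integral => //.
    - apply: measurable_funS mn => // t /=; rewrite !in_itv/= !andbT.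
      exact: le_trans (ltW ec).
    - apply: measurable_funeM; apply/measurable_EFinP.
      by apply: measurable_funTS; exact: measurable_powR.
    - move=> t; rewrite /= in_itv/= andbT => et.
      rewrite -EFinM lee_fin; apply: err_sym_far => //.
      exact: lt_le_trans et.
  rewrite ge0_integralZl//; first last.
  - by move=> t _; rewrite lee_fin powR_ge0.
  - by apply/measurable_EFinP; apply: measurable_funTS; exact: measurable_powR.
  rewrite integral_powR_tail// -EFinM lee_fin; move: (err_const p) (err_const_ge0 p2) => K KK.
  rewrite -!mulrA ler_wpM2l// !mulrA.
  rewrite ler_wpM2r ?invr_ge0 ?(ltW s0)//.
  have -> : c `^ (s * (p - 2)) = c `^ (s * (p - 1)) * c `^ (- s).
    by rewrite -powRDp//; congr (_ `^ _); ring.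
  rewrite -mulrA ler_wpM2l ?powR_ge0// [leRHS]mulrC.
  by have := @powR_quarter R c (- s) 1 c0; rewrite expr1; apply; hlra.
apply: (le_trans (leeD near far)); rewrite -EFinD lee_fin.
by rewrite le_eqVlt; apply/orP; left; apply/eqP; ring.
Qed.

Definition line_const : R :=
  2 * 5 `^ (p - 1) * half_const + err_const p * ((1 - s)^-1 + 4 / s).

Let half_const_ge0 : 0 <= half_const.
Proof. by rewrite /half_const addr_ge0// invr_ge0 mulr_ge0 ?(ltW s0)//; hlra. Qed.

Let e_lt_c4 (e : R) : e < a / 4 -> e < c / 4.
Proof. by move: a0 ab => *; lra. Qed.

(** Both terms are homogeneous of degree s (p - 2) in (a, b, e), as scaling
    demands; only the second one, which vanishes with e, involves the distance
    to the boundary. *)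
Lemma chord_sym_integral_le (e : R) : 0 < e -> e < a / 4 ->
  `|\int[mu]_(t in `[e, +oo[) chord_sym s p a b t| <=
  line_const * (c `^ (s * (p - 2)) + c `^ (s * (p - 1)) * (e `^ (1 - s) / a)).
Proof.
move=> e0 ea.
have ea' : e < a by move: a0 => *; lra.
have := chord_le_half_err e0 _ (@subset_refl _ _) (half_sym_integral e0 ea')
  (err_sym_integral e0 (e_lt_c4 ea)).
move=> /(_ (measurable_itv _)) /le_trans; apply.
rewrite /line_const.
have := err_const_ge0 p2; have := powR_ge0 c (s * (p - 2)); have := powR_ge0 (5 : R) (p - 1).
have : 0 <= c `^ (s * (p - 1)) * (e `^ (1 - s) / a).
  by rewrite mulr_ge0 ?powR_ge0// divr_ge0 ?powR_ge0// ltW.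
have : 0 <= (1 - s)^-1 + 4 / s by rewrite addr_ge0 ?invr_ge0 ?divr_ge0 ?subr_ge0 ?ltW.
have := half_const_ge0.
set X := c `^ (s * (p - 1)); set Y := e `^ _ / a; set Z := c `^ _.
set A := half_const; set B := 5 `^ _; set C := err_const p; set D := (_ + _ / s).
have -> : B * X * (A * Y) + C * D * Z = B * A * (X * Y) + C * D * Z by ring.
set W := X * Y => hA hD hW hB hZ hC.
have h1 : 0 <= B * A by exact: mulr_ge0.
have h2 : 0 <= C * D by exact: mulr_ge0.
have := mulr_ge0 h1 hW; have := mulr_ge0 h2 hW; have := mulr_ge0 h1 hZ; lra.
Qed.

Lemma chord_sym_annulus_le (e' e : R) : 0 < e' -> e' < e -> e < a / 4 ->
  `|\int[mu]_(t in `[e', e[) chord_sym s p a b t| <=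
  line_const * (c `^ (s * (p - 1)) * (e `^ (1 - s) / a)).
Proof.
move=> e'0 ee ea.
have e0 := lt_trans e'0 ee.
have ea' : e < a by move: a0 => *; lra.
have s1' : 0 < 1 - s by rewrite subr_gt0.
have hB : (\int[mu]_(t in `[e', e[) `|err_sym s p a b t|%:E <=
    (err_const p * ((1 - s)^-1 + 4 / s) * (c `^ (s * (p - 1)) * (e `^ (1 - s) / a)))%:E)%E.
  have /integrableP[/measurable_EFinP m _] := integrable_err_sym e'0.
  apply: (@le_trans _ _ (\int[mu]_(t in `[e', e]) `|err_sym s p a b t|%:E)%E).
    apply: ge0_subset_integral => //.
    - apply/measurable_EFinP; apply: measurableT_comp => //.
      by apply: measurable_funS m => // t /=; rewrite !in_itv/= andbT => /andP[].
    - by move=> t /=; rewrite !in_itv/= => /andP[-> /ltW ->].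
  apply: (le_trans (err_sym_integral_annulus e'0 ee (ltW (e_lt_c4 ea)))).
  rewrite lee_fin; move: (err_const p) (err_const_ge0 p2) => K KK.
  rewrite -!mulrA ler_wpM2l//.
  have -> : c `^ (s * (p - 1) - 1) = c `^ (s * (p - 1)) * c^-1.
    by rewrite powRDp// powR_inv1// ltW.
  have ca : c^-1 <= a^-1 by rewrite lef_pV2 ?posrE// lerDl (le_trans (ltW a0)).
  have -> : ((1 - s)^-1 + 4 / s) * (c `^ (s * (p - 1)) * (e `^ (1 - s) / a)) =
    c `^ (s * (p - 1)) * (a^-1 * (e `^ (1 - s) / (1 - s))) +
    4 / s * (c `^ (s * (p - 1)) * (e `^ (1 - s) / a)) by ring.
  apply: ler_wpDr.
    by rewrite mulr_ge0 ?divr_ge0 ?(ltW s0)// mulr_ge0 ?powR_ge0// divr_ge0 ?powR_ge0// ltW.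
  rewrite -mulrA ler_wpM2l ?powR_ge0// ler_wpM2r// divr_ge0 ?powR_ge0//.
  exact: ltW.
have sub : (`[e', e[%classic : set (measurableTypeR R)) `<=` `[e', +oo[%classic.
  by move=> t /=; rewrite !in_itv/= andbT => /andP[].
have := chord_le_half_err e'0 (measurable_itv _) sub
  (half_sym_integral_annulus e'0 ee ea') hB.
move=> /le_trans; apply; rewrite /line_const.
by rewrite le_eqVlt; apply/orP; left; apply/eqP; ring.
Qed.

End near_end.

Lemma line_const_ge0 : 0 <= line_const.
Proof.
have hK : 0 <= half_const.
  by rewrite /half_const addr_ge0// invr_ge0 mulr_ge0 ?(ltW s0)//; hlra.
have hs : 0 <= (1 - s)^-1 + 4 / s.
  by rewrite addr_ge0 ?invr_ge0 ?divr_ge0 ?subr_ge0 ?ltW.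
apply: addr_ge0; apply: mulr_ge0 => //; exact: err_const_ge0.
Qed.

Lemma chord_symC (a b : R) : chord_sym s p a b = chord_sym s p b a.
Proof.
apply/funext => t; rewrite /chord_sym addrC.
have E u : chord_profile s a b u = chord_profile s b a (- u).
  by rewrite /chord_profile opprK mulrC.
by rewrite !E opprK oppr0.
Qed.

Lemma integrable_chord (a b e : R) : 0 < a -> 0 < b -> 0 < e ->
  mu.-integrable `[e, +oo[ (EFin \o chord_sym s p a b).
Proof.
move=> a0 b0 e0; have [ab|/ltW ba] := leP a b; first exact: integrable_chord_sym.
by rewrite chord_symC; exact: integrable_chord_sym.
Qed.

Lemma line_bound (a b d e : R) : 0 < d -> d <= a -> d <= b -> 0 < e -> e < d / 4 ->
  `|\int[mu]_(t in `[e, +oo[) chord_sym s p a b t| <=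
  line_const * ((a + b) `^ (s * (p - 2)) + (a + b) `^ (s * (p - 1)) * (e `^ (1 - s) / d)).
Proof.
move=> d0; wlog ab : a b / a <= b => [wl da db e0 ed|da db e0 ed].
  have [/wl|/ltW/wl] := leP a b; first by apply.
  by rewrite chord_symC (addrC a); apply.
have a0 := lt_le_trans d0 da.
apply: (le_trans (chord_sym_integral_le a0 ab e0 _)); first lra.
rewrite ler_wpM2l ?line_const_ge0// lerD2l ler_wpM2l ?powR_ge0// ler_wpM2l ?powR_ge0//.
by rewrite lef_pV2 ?posrE.
Qed.

Lemma line_annulus_bound (a b d e' e : R) : 0 < d -> d <= a -> d <= b ->
  0 < e' -> e' < e -> e < d / 4 ->
  `|\int[mu]_(t in `[e', e[) chord_sym s p a b t| <=
  line_const * ((a + b) `^ (s * (p - 1)) * (e `^ (1 - s) / d)).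
Proof.
move=> d0; wlog ab : a b / a <= b => [wl da db e0 ee ed|da db e0 ee ed].
  have [/wl|/ltW/wl] := leP a b; first by apply.
  by rewrite chord_symC (addrC a); apply.
have a0 := lt_le_trans d0 da.
apply: (le_trans (chord_sym_annulus_le a0 ab e0 ee _)); first lra.
rewrite ler_wpM2l ?line_const_ge0// ler_wpM2l ?powR_ge0// ler_wpM2l ?powR_ge0//.
by rewrite lef_pV2 ?posrE.
Qed.

End line_integrals.

(** * The ball function along the lines through a point *)

Section ball_power_bound.
Variables (R : realType) (s p : R) (m : nat).
Hypotheses (s0 : 0 < s) (s1 : s < 1) (p2 : 2 < p).
Ltac hlra := move: s0 s1 p2 => *; lra.
Local Notation mu := (@lebesgue_measure R).
Local Notation lambda := (lebesgue_measure_Rn R m.+1).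
Local Notation u := (@ball_power R m.+1 s).

Lemma enorm_ge0 n (y : Rn R n) : 0 <= enorm y.
Proof. exact: sqrtr_ge0. Qed.

Lemma sqr_enorm n (y : Rn R n) : enorm y ^+ 2 = \sum_(i < n) tnth y i ^+ 2.
Proof. by rewrite sqr_sqrtr// sumr_ge0// => i _; exact: sqr_ge0. Qed.

Lemma ball_powerE n (y : Rn R n) : ball_power s y = pos (1 - enorm y ^+ 2) `^ s.
Proof.
rewrite /ball_power; case: ltP => y1.
  by rewrite posE// subr_ge0 expr_le1// ?enorm_ge0// ltW.
rewrite pos0; last by rewrite subr_le0 expr_ge1// enorm_ge0.
by rewrite powR0// gt_eqF.
Qed.

(** The restriction of 1 - |y|^2 to a line is a quadratic polynomial with two
    real roots, of opposite signs since x is inside.  Its maximum is at most 1,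
    which bounds the chord; the product of the roots is known, so the bound on
    the chord gives a lower bound on each of them. *)
Lemma ray_roots (x : Rn R m.+1) (eta : Rn R m) : enorm x < 1 ->
  exists a b : R,
  [/\ (1 - enorm x ^+ 2) / (2 * speed eta) <= a,
      (1 - enorm x ^+ 2) / (2 * speed eta) <= b,
      a + b <= 2 / speed eta &
      forall t, 1 - enorm (ray x t eta) ^+ 2 =
        speed eta ^+ 2 * ((a + t) * (b - t))].
Proof.
move=> x1; set d := 1 - enorm x ^+ 2.
have d0 : 0 < d by rewrite subr_gt0 expr_lt1 ?enorm_ge0.
have l0 := speed_gt0 eta; set l := speed eta in l0 *.
pose B := \sum_(i < m.+1) tnth x i * tnth (cons_Rn ((1 : R), eta)) i.
have E t : 1 - enorm (ray x t eta) ^+ 2 = d - 2 * B * t - l ^+ 2 * t ^+ 2.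
  rewrite /d /l /speed !sqr_enorm /B.
  rewrite (_ : \sum_(i < m.+1) tnth (ray x t eta) i ^+ 2 =
    \sum_(i < m.+1) tnth x i ^+ 2 +
    2 * t * (\sum_(i < m.+1) tnth x i * tnth (cons_Rn ((1 : R), eta)) i) +
    t ^+ 2 * \sum_(i < m.+1) tnth (cons_Rn ((1 : R), eta)) i ^+ 2); first ring.
  rewrite !mulr_sumr -!big_split/=; apply: eq_bigr => i _.
  rewrite /ray tnth_mktuple; ring.
pose D := Num.sqrt (B ^+ 2 + l ^+ 2 * d).
have D2 : D ^+ 2 = B ^+ 2 + l ^+ 2 * d.
  by rewrite sqr_sqrtr// addr_ge0 ?sqr_ge0// mulr_ge0 ?sqr_ge0// ltW.
have DB : `|B| < D.
  rewrite -sqrtr_sqr ltr_sqrt; first by rewrite ltrDl mulr_gt0// exprn_gt0.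
  by rewrite ltr_wpDl ?sqr_ge0// mulr_gt0// exprn_gt0.
have [DB1 DB2] : - D < B /\ B < D by move: DB; rewrite ltr_norml => /andP.
pose a := (B + D) / l ^+ 2; pose b := (D - B) / l ^+ 2.
have l20 : 0 < l ^+ 2 by rewrite exprn_gt0.
have a0 : 0 < a by rewrite divr_gt0//; lra.
have b0 : 0 < b by rewrite divr_gt0//; lra.
have P t : l ^+ 2 * ((a + t) * (b - t)) = d - 2 * B * t - l ^+ 2 * t ^+ 2.
  have -> : d = (D ^+ 2 - B ^+ 2) / l ^+ 2 by rewrite D2; field; rewrite gt_eqF.
  by rewrite /a /b; field; rewrite gt_eqF.
have Pab : l ^+ 2 * (a * b) = d.
  by have := P 0; rewrite !addr0 subr0 => ->; ring.
have cl : l * (a + b) <= 2.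
  (* At the midpoint of the chord the polynomial is (l (a + b) / 2)^2. *)
  have := P ((b - a) / 2); rewrite -E => H.
  have H2 : (l * (a + b)) ^+ 2 <= 2 ^+ 2.
    have := sqr_ge0 (enorm (ray x ((b - a) / 2) eta)); nra.
  by move: H2; rewrite ler_sqr// nnegrE// mulr_ge0 ?addr_ge0 ?ltW.
exists a, b; split.
- rewrite ler_pdivrMr ?mulr_gt0// -Pab.
  have := mulr_gt0 l0 a0; have := mulr_gt0 l0 b0 => ? ?; nra.
- rewrite ler_pdivrMr ?mulr_gt0// -Pab.
  have := mulr_gt0 l0 a0; have := mulr_gt0 l0 b0 => ? ?; nra.
- by rewrite ler_pdivlMr// mulrC.
- by move=> t; rewrite E P.
Qed.

Lemma ball_power_ray (x : Rn R m.+1) eta a b :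
  (forall t, 1 - enorm (ray x t eta) ^+ 2 =
    speed eta ^+ 2 * ((a + t) * (b - t))) ->
  forall t, u (ray x t eta) = (speed eta ^+ 2) `^ s * chord_profile s a b t.
Proof.
move=> H t; rewrite ball_powerE H /chord_profile -powRM ?pos_ge0 ?sqr_ge0//.
by rewrite posM// sqr_ge0.
Qed.

Lemma ray0 (x : Rn R m.+1) eta : ray x 0 eta = x.
Proof. by apply: eq_from_tnth => i; rewrite tnth_mktuple mul0r addr0. Qed.

Definition shell (x : Rn R m.+1) (S : set R) : set (Rn R m.+1) :=
  [set y | S (Defs.edist x y)].

Lemma measurable_edist (x : Rn R m.+1) : measurable_fun setT (Defs.edist x).
Proof.
apply: (@measurableT_comp _ _ _ _ _ _ (@Num.sqrt R)).
  by apply: continuous_measurable_fun; exact: sqrt_continuous.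
apply: measurable_sum => i; apply: measurable_funX.
apply: measurable_funB => //; exact: measurable_tnth.
Qed.

Lemma measurable_shell x (S : set R) :
  measurable (S : set (measurableTypeR R)) -> measurable (shell x S).
Proof.
by move=> mS; rewrite -[X in measurable X]setTI; exact: measurable_edist.
Qed.

Lemma measurable_kernel x : measurable_fun setT (fracp_kernel s p u x).
Proof.
have mu_ : measurable_fun setT (fun y => u x - u y).
  apply: measurable_funB => //.
  have -> : u = fun y => pos (1 - enorm y ^+ 2) `^ s.
    by apply/funext => y; exact: ball_powerE.
  apply: (measurableT_comp (@measurable_pos_powR R s)).
  apply: measurable_funB => //; apply: measurable_funX; exact: measurable_enorm.
apply: measurable_funM; first exact: (measurableT_comp (@measurable_spow R p) mu_).
under eq_fun do rewrite -powRN.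
exact: (measurableT_comp (measurable_powR _) (measurable_edist x)).
Qed.

(** The powers of the speed coming from the profile, the kernel and the
    Jacobian combine so that, for chords of length 2 / speed, exactly the
    integrable weight is left. *)
Lemma pencil_shell_kernel (x : Rn R m.+1) eta a b (S : set R) t :
  (forall t, 1 - enorm (ray x t eta) ^+ 2 =
    speed eta ^+ 2 * ((a + t) * (b - t))) -> 0 < t ->
  pencil x (fracp_kernel s p u x \_ (shell x S)) (t, eta) =
  (speed eta) `^ (s * (p - 2)) * (speed eta)^-1 ^+ m.+1 *
   (chord_sym s p a b \_ [set t | S (t * speed eta)]) t.
Proof.
move=> H t0; have l0 := speed_gt0 eta; set l := speed eta in H l0 *.
have nt : `|t| = t by rewrite gtr0_norm.
have nNt : `|- t| = t by rewrite normrN.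
have shE r : `|r| = t -> (ray x r eta \in shell x S) = (t \in [set t | S (t * l)]).
  by move=> rt; rewrite /shell; apply/idP/idP; rewrite !inE/= edist_ray rt.
set J := [set t | S (t * l)] in shE *.
have kE r : `|r| = t -> (fracp_kernel s p u x \_ (shell x S)) (ray x r eta) =
    if t \in J then fracp_kernel s p u x (ray x r eta) else 0.
  by move=> rt; rewrite patchE; congr (if _ then _ else _); exact: shE.
transitivity (t ^+ m * ((if t \in J then fracp_kernel s p u x (ray x t eta) else 0) +
    (if t \in J then fracp_kernel s p u x (ray x (- t) eta) else 0))).
  by rewrite /pencil/= t0; congr (_ * (_ + _)); exact: kE.
rewrite patchE; case: ifPn => _; last by rewrite addr0 !mulr0.
have ker r : `|r| = t -> fracp_kernel s p u x (ray x r eta) =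
    (l ^+ 2) `^ (s * (p - 1)) *
    spow p (chord_profile s a b 0 - chord_profile s a b r) *
    (t * l) `^ (- (m.+1%:R + s * p)).
  move=> rt; rewrite /fracp_kernel edist_ray rt -powRN -/l; congr (_ * _).
  rewrite -/(spow p (u x - u (ray x r eta))) -{1}(ray0 x eta).
  rewrite !(ball_power_ray H) -/l -mulrBr spowM; congr (_ * _).
  rewrite spow_ge0E ?powR_ge0//; last hlra.
  by rewrite -powRrM.
rewrite (ker _ nt) (ker _ nNt) /chord_sym.
rewrite -mulrDl -mulrDr (powRM _ (ltW t0) (ltW l0)).
have tE : t ^+ m * t `^ (- (m.+1%:R + s * p)) = t `^ (- (1 + s * p)).
  rewrite -powR_mulrn ?(ltW t0)// -powRDp//; congr (_ `^ _).
  rewrite -natr1; ring.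
have lE : (l ^+ 2) `^ (s * (p - 1)) * l `^ (- (m.+1%:R + s * p)) =
    l `^ (s * (p - 2)) * l^-1 ^+ m.+1.
  rewrite -powR_mulrn ?(ltW l0)// -powRrM exprVn -powR_invn ?(ltW l0)// -!powRDp//.
  by congr (_ `^ _); ring.
rewrite -lE -tE; ring.
Qed.

(** As 0 <= u <= 1, the kernel is dominated by the power -(n + s p) of the
    distance to x. *)
Lemma integrable_kernel x (e : R) : 0 < e ->
  lambda.-integrable setT
    (EFin \o (fracp_kernel s p u x \_ (shell x `[e, +oo[%classic))).
Proof.
move=> e0; have sp0 : 0 < s * p by rewrite mulr_gt0//; hlra.
set D := shell x _.
have mD : measurable D by exact: measurable_shell.
pose f : Rn R m.+1 -> R := (fun y => Defs.edist x y `^ (- (m.+1%:R + s * p))) \_ D.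
have mf : measurable_fun setT f.
  rewrite /f; apply/(measurable_restrictT _ mD); apply: measurable_funTS.
  by apply: (measurableT_comp (@measurable_powR R _)); exact: measurable_edist.
have f0 y : 0 <= f y by rewrite /f patchE; case: ifP => // _; exact: powR_ge0.
have intf : lambda.-integrable setT (EFin \o f).
  apply/integrableP; split; first exact/measurable_EFinP.
  under eq_integral do rewrite /= ger0_norm//.
  apply: (@le_lt_trans _ _
    (2 * (e `^ (- (s * p)) / (s * p)) * total_weight R m)%:E); last by rewrite ltey.
  apply: (@ge0_integral_le_weight R m x f) => //.
    by rewrite mulr_ge0// divr_ge0 ?powR_ge0// ltW.
  move=> eta; have l0 := speed_gt0 eta; set l := speed eta in l0 *.
  have el0 : 0 < e / l by rewrite divr_gt0.
  rewrite (_ : (\int[mu]_t (pencil x f (t, eta))%:E)%E =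
    (\int[mu]_(t in `[(e / l)%R, +oo[)
      ((2 * l `^ (- (m.+1%:R + s * p)))%:E * (t `^ (- (1 + s * p)))%:E))%E); last first.
    rewrite [RHS]integral_mkcond; apply: eq_integral => t _.
    rewrite patchE mem_setE in_itv/= andbT.
    have [t0|t0] := ltP 0 t; last first.
      rewrite /pencil/= ltNge t0/= ifF//; apply/negbTE.
      by rewrite -ltNge (le_lt_trans t0).
    have fr r : `|r| = t -> f (ray x r eta) =
        if e / l <= t then (t * l) `^ (- (m.+1%:R + s * p)) else 0.
      move=> rt; rewrite /f patchE edist_ray rt -/l ler_pdivrMr//.
      congr (if _ then _ else _); apply/idP/idP;
        rewrite inE /D /shell/= edist_ray rt in_itv/= andbT//.
    rewrite /pencil/= t0 !fr ?normrN ?gtr0_norm//; case: ifP => _; last by rewrite addr0 mulr0.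
    rewrite -EFinM; congr EFin; rewrite powRM ?(ltW t0) ?(ltW l0)//.
    have <- : t ^+ m * t `^ (- (m.+1%:R + s * p)) = t `^ (- (1 + s * p)).
      rewrite -powR_mulrn ?(ltW t0)// -powRDp//; congr (_ `^ _).
      rewrite -natr1; ring.
    ring.
  rewrite ge0_integralZl//; first last.
  - by rewrite lee_fin mulr_ge0 ?powR_ge0.
  - by move=> t _; rewrite lee_fin powR_ge0.
  - by apply/measurable_EFinP; apply: measurable_funTS; exact: measurable_powR.
  rewrite integral_powR_tail// -EFinM lee_fin.
  rewrite powRM ?(ltW e0) ?invr_ge0 ?(ltW l0)//.
  have -> : l^-1 `^ (- (s * p)) = l `^ (s * p).
    by rewrite -[l^-1]powR_inv1 ?(ltW l0)// -powRrM; congr (_ `^ _); ring.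
  have -> : l^-1 ^+ m.+1 = l `^ (- (m.+1%:R + s * p)) * l `^ (s * p).
    by rewrite exprVn -powR_invn ?(ltW l0)// -powRDp//; congr (_ `^ _); ring.
  by rewrite le_eqVlt; apply/orP; left; apply/eqP; ring.
apply: le_integrable intf => //.
  apply/measurable_EFinP; apply/(measurable_restrictT _ mD).
  by apply: measurable_funTS; exact: measurable_kernel.
move=> y _; rewrite lee_fin /f !patchE; case: ifPn => // _.
have u01 (z : Rn R m.+1) : 0 <= u z <= 1.
  have h1 : (1 : R) `^ s = 1 by rewrite powR1.
  rewrite ball_powerE powR_ge0/= -[leRHS]h1 ge0_ler_powR ?nnegrE ?(ltW s0) ?pos_ge0//.
  by rewrite /pos ge_max ler01/= gerBl sqr_ge0.
rewrite /fracp_kernel -powRN [X in X <= _]normrM -/(spow p _) norm_spow; last hlra.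
rewrite (ger0_norm (powR_ge0 _ _)) ler_piMl ?powR_ge0//.
have h : `|u x - u y| <= 1.
  move: (u x) (u y) (u01 x) (u01 y) => X Y /andP[? ?] /andP[? ?].
  by rewrite ler_norml; apply/andP; split; lra.
move: (u x - u y) h => X h.
have : `|X| `^ (p - 1) <= 1 `^ (p - 1) by rewrite ge0_ler_powR ?nnegrE//; hlra.
by rewrite powR1.
Qed.

End ball_power_bound.

(** * Truncated integrals over R^n *)

Section principal_value.
Variables (R : realType) (s p : R) (m : nat).
Hypotheses (s0 : 0 < s) (s1 : s < 1) (p2 : 2 < p).
Ltac hlra := move: s0 s1 p2 => *; lra.
Local Notation mu := (@lebesgue_measure R).
Local Notation lambda := (lebesgue_measure_Rn R m.+1).
Local Notation u := (@ball_power R m.+1 s).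

Lemma integral_pencil_shell (x : Rn R m.+1) eta a b (S : set R)
    (J : set (measurableTypeR R)) e :
  (forall t, 1 - enorm (ray x t eta) ^+ 2 =
    speed eta ^+ 2 * ((a + t) * (b - t))) ->
  0 < a -> 0 < b -> 0 < e -> measurable J -> J `<=` `[e, +oo[%classic ->
  (forall t, 0 < t -> J t <-> S (t * speed eta)) ->
  (\int[mu]_t (pencil x (fracp_kernel s p u x \_ (shell x S)) (t, eta))%:E =
   (speed eta `^ (s * (p - 2)) * (speed eta)^-1 ^+ m.+1 *
    \int[mu]_(t in J) chord_sym s p a b t)%:E)%E.
Proof.
move=> H a0 b0 e0 mJ Je JS.
have intJ : mu.-integrable J (EFin \o chord_sym s p a b).
  by apply: (integrableS _ mJ Je) => //; exact: integrable_chord.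
rewrite EFinM /Rintegral fineK; last exact: integrable_fin_num.
rewrite -integralZl// [RHS]integral_mkcond; apply: eq_integral => t _.
have [t0|t0] := ltP 0 t.
  rewrite (pencil_shell_kernel s0 s1 p2 S H t0) !patchE EFinM.
  have -> : (t \in [set t | S (t * speed eta)]) = (t \in J).
    by apply/idP/idP; rewrite !inE/= JS.
  by case: ifP => //; rewrite mule0.
rewrite patchE ifF /pencil/= ?ltNge ?t0//; apply/negbTE.
rewrite notin_setE => /Je; rewrite /= in_itv/= andbT => et.
by have := lt_le_trans e0 (le_trans et t0); rewrite ltxx.
Qed.

(** The chord has length at most 2 / speed, which compensates the speed. *)
Lemma speed_power_le (l c r : R) : 0 < l -> 0 <= c -> c <= 2 / l -> 0 <= r ->
  l `^ r * c `^ r <= 2 `^ r.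
Proof.
move=> l0 c0 cl r0; rewrite -powRM ?(ltW l0)//.
rewrite ge0_ler_powR ?nnegrE ?mulr_ge0 ?(ltW l0)//.
by rewrite mulrC -ler_pdivlMr.
Qed.

Lemma speed_tail_le (l c e d : R) : 0 < l -> 0 <= c -> c <= 2 / l -> 0 < e -> 0 < d ->
  l `^ (s * (p - 2)) * (c `^ (s * (p - 1)) * ((e / l) `^ (1 - s) / (d / (2 * l)))) <=
  2 * 2 `^ (s * (p - 1)) * (e `^ (1 - s) / d).
Proof.
move=> l0 c0 cl e0 d0.
have -> : l `^ (s * (p - 2)) = l `^ (s * (p - 1)) * l `^ (- s).
  by rewrite -powRDp//; congr (_ `^ _); ring.
rewrite powRM ?(ltW e0) ?invr_ge0 ?(ltW l0)//.
have -> : l^-1 `^ (1 - s) = l `^ (s - 1).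
  by rewrite -[l^-1]powR_inv1 ?(ltW l0)// -powRrM; congr (_ `^ _); ring.
have lE : l `^ (- s) * l `^ (s - 1) * l = 1.
  transitivity (l `^ (- s) * l `^ (s - 1) * l `^ 1).
    by rewrite [l `^ 1]powRr1// ltW.
  rewrite -!powRDp// -[RHS](powRr0 l); congr (_ `^ _); ring.
have -> : l `^ (s * (p - 1)) * l `^ (- s) *
    (c `^ (s * (p - 1)) * (e `^ (1 - s) * l `^ (s - 1) / (d / (2 * l)))) =
    (l `^ (- s) * l `^ (s - 1) * l) *
    (2 * (l `^ (s * (p - 1)) * c `^ (s * (p - 1))) * (e `^ (1 - s) / d)).
  by field; rewrite !gt_eqF.
rewrite lE mul1r ler_wpM2r ?divr_ge0 ?powR_ge0 ?(ltW d0)// ler_wpM2l//.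
by apply: speed_power_le => //; rewrite mulr_ge0 ?(ltW s0)//; hlra.
Qed.

Let K := line_const s p.
Let W := total_weight R m.

Let K0 : 0 <= K. Proof. exact: line_const_ge0. Qed.

Section at_point.
Variable x : Rn R m.+1.
Hypothesis x1 : enorm x < 1.
Let d := 1 - enorm x ^+ 2.
Let d0 : 0 < d. Proof. by rewrite subr_gt0 expr_lt1 ?enorm_ge0. Qed.

Let tail (e : R) := 2 * 2 `^ (s * (p - 1)) * (e `^ (1 - s) / d).

Let tail_ge0 e : 0 <= tail e.
Proof.
apply: mulr_ge0; first by rewrite mulr_ge0 ?powR_ge0.
by rewrite divr_ge0 ?powR_ge0 ?(ltW d0).
Qed.

(** The size of a truncation is uniform in x up to a term that vanishes with the
    radius. *)
Lemma exterior_bound (e : R) : 0 < e -> e < d / 8 ->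
  (`|\int[lambda]_y ((fracp_kernel s p u x \_ (shell x `[e, +oo[%classic)) y)%:E| <=
   (K * (2 `^ (s * (p - 2)) + tail e) * W)%:E)%E.
Proof.
move=> e0 ed; apply: (integral_le_weight (x := x)).
- exact: integrable_kernel.
- by rewrite mulr_ge0// addr_ge0 ?powR_ge0.
move=> eta; have l0 := speed_gt0 eta.
have [a [b [da db cl H]]] := ray_roots eta x1.
have dl0 : 0 < d / (2 * speed eta) by rewrite divr_gt0// mulr_gt0.
have a0 := lt_le_trans dl0 da; have b0 := lt_le_trans dl0 db.
have el0 : 0 < e / speed eta by rewrite divr_gt0.
have c0 : 0 <= a + b by rewrite addr_ge0 ?ltW.
rewrite (@integral_pencil_shell x eta a b _
  `[e / speed eta, +oo[%classic (e / speed eta))//; last first.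
  by move=> t t0; rewrite /= !in_itv/= !andbT ler_pdivrMr.
have small : e / speed eta < d / (2 * speed eta) / 4.
  have -> : d / (2 * speed eta) / 4 = d / 8 / speed eta by field; rewrite gt_eqF.
  by rewrite ltr_pM2r// invr_gt0.
rewrite abse_EFin lee_fin !normrM (ger0_norm (powR_ge0 _ _)).
rewrite (ger0_norm (exprn_ge0 _ (_ : 0 <= (speed eta)^-1))) ?invr_ge0 ?(ltW l0)//.
rewrite [leLHS]mulrAC ler_wpM2r ?exprn_ge0 ?invr_ge0 ?(ltW l0)//.
have := line_bound s0 s1 p2 dl0 da db el0 small.
move=> /(ler_wpM2l (powR_ge0 (speed eta) (s * (p - 2)))) /le_trans; apply.
rewrite mulrCA ler_wpM2l// mulrDr; apply: lerD.
  by apply: speed_power_le => //; rewrite mulr_ge0 ?(ltW s0)//; hlra.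
exact: speed_tail_le.
Qed.

(** The oscillation between two truncations has no such uniform part. *)
Lemma annulus_bound (e' e : R) : 0 < e' -> e' < e -> e < d / 8 ->
  (`|\int[lambda]_y ((fracp_kernel s p u x \_ (shell x `[e', e[%classic)) y)%:E| <=
   (K * tail e * W)%:E)%E.
Proof.
move=> e'0 ee ed; have e0 := lt_trans e'0 ee.
apply: (integral_le_weight (x := x)).
- have -> : EFin \o fracp_kernel s p u x \_ (shell x `[e', e[%classic) =
    ((EFin \o (fracp_kernel s p u x \_ (shell x `[e', +oo[%classic))) \_
      (shell x `[e', e[%classic))%E.
    apply/funext => y; rewrite /= !patchE; case: ifPn => // h.
    rewrite /= patchE ifT//; move: h; rewrite !inE /shell/= !in_itv/= andbT.
    by case/andP.
  apply/(integrable_mkcond _ _).1 => //; first exact: measurable_shell.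
  apply: (@integrableS _ _ _ _ setT) => //; first exact: measurable_shell.
  exact: integrable_kernel.
- by rewrite mulr_ge0.
move=> eta; have l0 := speed_gt0 eta.
have [a [b [da db cl H]]] := ray_roots eta x1.
have dl0 : 0 < d / (2 * speed eta) by rewrite divr_gt0// mulr_gt0.
have a0 := lt_le_trans dl0 da; have b0 := lt_le_trans dl0 db.
have el0 : 0 < e' / speed eta by rewrite divr_gt0.
have c0 : 0 <= a + b by rewrite addr_ge0 ?ltW.
rewrite (@integral_pencil_shell x eta a b _
  `[e' / speed eta, e / speed eta[%classic (e' / speed eta))//; last 2 first.
- by move=> t /=; rewrite !in_itv/= andbT => /andP[].
- by move=> t t0; rewrite /= !in_itv/= ler_pdivrMr// ltr_pdivlMr.
have small : e / speed eta < d / (2 * speed eta) / 4.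
  have -> : d / (2 * speed eta) / 4 = d / 8 / speed eta by field; rewrite gt_eqF.
  by rewrite ltr_pM2r// invr_gt0.
have eel : e' / speed eta < e / speed eta by rewrite ltr_pM2r// invr_gt0.
rewrite abse_EFin lee_fin !normrM (ger0_norm (powR_ge0 _ _)).
rewrite (ger0_norm (exprn_ge0 _ (_ : 0 <= (speed eta)^-1))) ?invr_ge0 ?(ltW l0)//.
rewrite [leLHS]mulrAC ler_wpM2r ?exprn_ge0 ?invr_ge0 ?(ltW l0)//.
have := line_annulus_bound s0 s1 p2 dl0 da db el0 eel small.
move=> /(ler_wpM2l (powR_ge0 (speed eta) (s * (p - 2)))) /le_trans; apply.
rewrite mulrCA ler_wpM2l//.
exact: speed_tail_le.
Qed.

End at_point.
End principal_value.

(** * The principal value *)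

Section cauchy_at_0.
Variable R : realType.

(** The rate may depend on anything but the two radii, so this applies at each
    point x separately. *)
Lemma cvg_at_right0_cauchy (F : R -> R) (M r d : R) : 0 < d -> 0 < r -> 0 <= M ->
  (forall e' e, 0 < e' -> e' < e -> e < d -> `|F e' - F e| <= M * e `^ r) ->
  cvg (F e @[e --> 0^'+]).
Proof.
move=> d0 r0 M0 FM; apply: cauchy_cvg; apply: cauchy_exP => eps eps0.
pose e0 := Num.min (d / 2) ((eps / (M + 1)) `^ r^-1).
have M10 : 0 < M + 1 by lra.
have q0 : 0 < eps / (M + 1) by rewrite divr_gt0.
have e00 : 0 < e0 by rewrite lt_min divr_gt0//= powR_gt0.
have e0d : e0 < d by rewrite gt_min; apply/orP; left; lra.
have Me : M * e0 `^ r < eps.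
  have : e0 `^ r <= eps / (M + 1).
    rewrite [leRHS](_ : _ = ((eps / (M + 1)) `^ r^-1) `^ r); last first.
      by rewrite -powRrM mulVf ?gt_eqF// powRr1// ltW.
    have e0q : e0 <= (eps / (M + 1)) `^ r^-1 by rewrite /e0 ge_min lexx orbT.
    by rewrite ge0_ler_powR ?nnegrE ?powR_ge0 ?(ltW r0) ?(ltW e00).
  rewrite ler_pdivlMr// => h; have := powR_gt0 r e00; nra.
exists (F e0).
suff : \forall e \near 0^'+, ball (F e0) eps (F e) by [].
near=> e; rewrite -ball_normE/= distrC.
apply: (le_lt_trans (FM _ _ _ _ e0d)) => //.
Unshelve. all: by end_near. Qed.

End cauchy_at_0.

Section main.
Variables (R : realType) (s p : R) (m : nat).
Hypotheses (s0 : 0 < s) (s1 : s < 1) (p2 : 2 < p).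
Ltac hlra := move: s0 s1 p2 => *; lra.
Local Notation lambda := (lebesgue_measure_Rn R m.+1).
Local Notation u := (@ball_power R m.+1 s).

Lemma setC_eball (x : Rn R m.+1) (e : R) : ~` Defs.eball x e = shell x `[e, +oo[%classic.
Proof.
apply/seteqP; split => y /=; rewrite /Defs.eball /shell/= in_itv/= andbT leNgt.
  by move/negP.
by move/negP.
Qed.

Lemma integrable_fracp_kernel (x : Rn R m.+1) (e : R) : 0 < e ->
  lambda.-integrable (~` Defs.eball x e) (EFin \o fracp_kernel s p u x).
Proof.
move=> e0; rewrite setC_eball.
apply/(integrable_mkcond _ _).2; first exact: measurable_shell.
rewrite restrict_EFin; exact: integrable_kernel.
Qed.

Lemma fracp_truncE (x : Rn R m.+1) (e : R) :
  (fracp_trunc s p u x e)%R =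
  fine (\int[lambda]_y ((fracp_kernel s p u x \_ (shell x `[e, +oo[%classic)) y)%:E)%E.
Proof. by rewrite /fracp_trunc setC_eball Rintegral_mkcond. Qed.

Lemma fracp_trunc_diff (x : Rn R m.+1) (e' e : R) : 0 < e' -> e' < e ->
  fracp_trunc s p u x e' - fracp_trunc s p u x e =
  fine (\int[lambda]_y ((fracp_kernel s p u x \_ (shell x `[e', e[%classic)) y)%:E)%E.
Proof.
move=> e'0 ee; have e0 := lt_trans e'0 ee.
rewrite -[RHS]/(Rintegral _ _ _) -Rintegral_mkcond /fracp_trunc.
have i' := integrable_fracp_kernel x e'0.
move: i'; rewrite !setC_eball.
have -> : shell x `[e', +oo[%classic =
    shell x `[e', e[%classic `|` shell x `[e, +oo[%classic.
  apply/seteqP; split => y; rewrite /shell/= !in_itv/= !andbT.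
    by move=> h; case: (ltP (Defs.edist x y) e) => te; [left; rewrite h|right].
  by move=> [/andP[]//|te]; exact: le_trans (ltW ee) te.
move=> i'; rewrite Rintegral_setU ?addrK//; try exact: measurable_shell.
apply/disj_setPS => y [] /=; rewrite /shell/= !in_itv/= andbT => /andP[_ te] /(lt_le_trans te).
by rewrite ltxx.
Qed.

(** The 1 absorbs the part of [exterior_bound] that depends on x, once the radius
    is small. *)
Definition pv_bound : R :=
  (line_const s p * (2 `^ (s * (p - 2)) + 1)) * total_weight R m.

Lemma pv_estimate (x : Rn R m.+1) : enorm x < 1 ->
  cvg (fracp_trunc s p u x e @[e --> 0^'+]) /\
  `|lim (fracp_trunc s p u x e @[e --> 0^'+])| <= pv_bound.
Proof.
move=> x1; set d := 1 - enorm x ^+ 2.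
have d0 : 0 < d by rewrite subr_gt0 expr_lt1 ?enorm_ge0.
have s1' : 0 < 1 - s by rewrite subr_gt0.
have K0 : 0 <= line_const s p by exact: line_const_ge0.
have W0 := total_weight_ge0 R m.
have fin_le (i : \bar R) (B : R) : (`|i| <= B%:E)%E -> `|fine i| <= B.
  by case: i => [r|//|//]; rewrite /= lee_fin.
pose T e := 2 * 2 `^ (s * (p - 1)) * (e `^ (1 - s) / d).
have FM e' e : 0 < e' -> e' < e -> e < d / 8 ->
    `|fracp_trunc s p u x e' - fracp_trunc s p u x e| <=
    (line_const s p * (2 * 2 `^ (s * (p - 1)) / d) * total_weight R m) * e `^ (1 - s).
  move=> e'0 ee ed; rewrite fracp_trunc_diff//.
  apply: (le_trans (fin_le _ _ (annulus_bound s0 s1 p2 x1 e'0 ee ed))).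
  by rewrite le_eqVlt; apply/orP; left; apply/eqP; rewrite -/d; ring.
have Fcvg : cvg (fracp_trunc s p u x e @[e --> 0^'+]).
  apply: (cvg_at_right0_cauchy (d := d / 8) _ s1' _ FM); first by rewrite divr_gt0.
  by rewrite mulr_ge0// mulr_ge0// divr_ge0 ?mulr_ge0 ?powR_ge0// ltW.
split => //.
have near_bound : \forall e \near 0^'+, `|fracp_trunc s p u x e| <= pv_bound.
  have Tcvg : T e @[e --> 0^'+] --> (0 : R).
    rewrite /T -[X in _ --> X](mulr0 (2 * 2 `^ (s * (p - 1)))).
    apply: cvgMr; rewrite -[X in _ --> X](mul0r d^-1).
    by apply: cvgMl; exact: powR_cvg0.
  have Tnear : \forall e \near 0^'+, `|0 - T e| < 1.
    by move/cvgrPdist_lt : Tcvg; apply.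
  near=> e.
  have e0 : 0 < e by near: e; exact: nbhs_right_gt.
  rewrite fracp_truncE.
  apply: (le_trans (fin_le _ _ (exterior_bound s0 s1 p2 x1 e0 _))).
    by near: e; apply: nbhs_right_lt; rewrite divr_gt0.
  rewrite /pv_bound ler_wpM2r// ler_wpM2l// lerD2l -/(T e).
  have : `|0 - T e| < 1 by near: e.
  by rewrite sub0r normrN => /ltW; exact/le_trans/ler_norm.
rewrite ler_norml; apply/andP; split.
- apply: limr_ge => //; near=> e.
  have : `|fracp_trunc s p u x e| <= pv_bound by near: e.
  by rewrite ler_norml => /andP[].
- apply: limr_le => //; near=> e.
  have : `|fracp_trunc s p u x e| <= pv_bound by near: e.
  by rewrite ler_norml => /andP[].
Unshelve. all: by end_near. Qed.

End main.

Theorem theorem1 (R : realType) (Cnsp : nat -> R -> R -> R) (s p : R) (n : nat)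
    (hs0 : 0 < s) (hs1 : s < 1) (hp : 2 < p) (hn : (1 <= n)%N) :
  exists C : R, forall x : Rn R n, enorm x < 1 ->
    fracp_laplacian_exists s p (ball_power s) x /\
    `|fracp_laplacian Cnsp s p (ball_power s) x| <= C.
Proof.
case: n hn => // m _.
exists (`|Cnsp m.+1 s p| * pv_bound s p m) => x x1.
have [Fcvg Flim] := pv_estimate hs0 hs1 hp x1.
split.
  by split => // e e0; exact: integrable_fracp_kernel.
by rewrite /fracp_laplacian normrM ler_wpM2l.
Qed.
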